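(* (Whitehead.) Let $M$ be a monoid. If $k\colon Y\to Z$ is an $M$-equivariant weak equivalence between projective $M$-CW complexes, then $k$ is an $M$-homotopy equivalence. Likewise, if $k\colon Y\to Z$ is an $M$-equivariant $n$-equivalence between projective $M$-CW complexes of dimension less than $n$, then $k$ is an $M$-homotopy equivalence.
   Context: Let $M$ be a monoid with the discrete topology. An $M$-set $P$ (set with left $M$-action) is projective if every surjective $M$-equivariant map onto $P$ has an $M$-equivariant section; equivalently $P\cong\coprod_{a\in A}Me_a$ with each $e_a\in M$ idempotent. An $M$-space is a topological space with a continuous left action of $M$; $M$-sets are regarded as discrete $M$-spaces. $I=[0,1]$, $B^n$ and $S^{n-1}=\partial B^n$ carry trivial $M$-actions. A projective $M$-CW complex is an $M$-space $X=\varinjlim X_n$ (along inclusions) where $X_0=P_0$ is a projective $M$-set and, for $n\ge1$, $X_n$ is a pushout of $M$-spaces $X_n=X_{n-1}\cup_{P_n\times S^{n-1}}(P_n\times B^n)$ along an $M$-equivariant continuous map $P_n\times S^{n-1}\to X_{n-1}$, with $P_n$ a projective $M$-set. Its dimension is $n$ if $X=X_n$ and $P_n\ne\emptyset$. A continuous map $f\colon X\to Y$ is an $n$-equivalence if $f_*\colon\pi_q(X,x)\to\pi_q(Y,f(x))$ is a bijection for $0\le q<n$ and a surjection for $q=n$, for all base points $x$ (with $\pi_0$ the set of path components). It is a weak equivalence if $f_*$ is a bijection for all $q\ge0$ and all base points. An $M$-homotopy between $M$-equivariant continuous maps $f,g\colon X\to Y$ is an $M$-equivariant continuous map $H\colon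 X\times I\to Y$ with $H(x,0)=f(x)$ and $H(x,1)=g(x)$; write $f\simeq_M g$. An $M$-equivariant continuous map $f\colon X\to Y$ is an $M$-homotopy equivalence if there is an $M$-equivariant continuous map $g\colon Y\to X$ with $gf\simeq_M1_X$ and $fg\simeq_M1_Y$. *)

(* Defs.v *)
From HB Require Import structures.
From mathcomp Require Import all_boot all_order all_algebra generic_quotient.
From mathcomp Require Import all_classical reals topology normedtype.

Set Implicit Arguments.
Unset Strict Implicit.
Unset Printing Implicit Defensive.

Import Order.TTheory GRing.Theory Num.Theory.
Import numFieldNormedType.Exports.

Local Open Scope classical_set_scope.
Local Open Scope quotient_scope.
Local Open Scope ring_scope.

HB.mixin Record isMSet (M : monoidType) (T : Type) := {
  act : M -> T -> T;
  act1 : forall x, act 1%g x = x;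
  actM : forall m n x, act (m * n)%g x = act m (act n x)
}.

#[short(type="msetType")]
HB.structure Definition MSet (M : monoidType) := {T of isMSet M T & Choice T}.

HB.mixin Record isMSpace (M : monoidType) (T : Type)
    of isMSet M T & Topological T := {
  act_continuous : continuous
    (fun p : (discrete_topology M * T)%type => (act p.1 p.2 : T))
}.

#[short(type="mspaceType")]
HB.structure Definition MSpace (M : monoidType) :=
  {T of isMSpace M T & MSet M T & Topological T}.

HB.mixin Record isEquivariant (M : monoidType) (X Y : msetType M)
    (f : X -> Y) := {
  equivariantE : forall m x, f (act m x) = act m (f x)
}.

#[short(type="equivariantType")]
HB.structure Definition Equivariant (M : monoidType) (X Y : msetType M) :=
  {f of isEquivariant M X Y f}.

#[short(type="mmapType")]
HB.structure Definition MMap (M : monoidType) (X Y : mspaceType M) :=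
  {f of isEquivariant M X Y f & @isContinuous X Y f}.

Notation "{ 'mmap' X -> Y }" := (mmapType X%type Y%type)
  (at level 0, X at level 98, Y at level 99) : type_scope.

HB.instance Definition _ (M : monoidType) (X : mspaceType M) :=
  isEquivariant.Build M X X idfun (fun _ _ => erefl).

Lemma equivariant_comp (M : monoidType) (X Y Z : msetType M)
    (f : equivariantType X Y) (g : equivariantType Y Z) (m : M) (x : X) :
  (g \o f) (act m x) = act m ((g \o f) x).
Proof. by rewrite /= !equivariantE. Qed.

HB.instance Definition _ (M : monoidType) (X Y Z : mspaceType M)
    (f : {mmap X -> Y}) (g : {mmap Y -> Z}) :=
  isEquivariant.Build M X Z (g \o f) (equivariant_comp f g).

(* M is discrete, so joint continuity may be checked one translation at a
   time. *)
Lemma act_continuousW (M : monoidType) (T : topologicalType) (a : M -> T -> T) :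
  (forall m, continuous (a m)) ->
  continuous (fun p : (discrete_topology M * T)%type => (a p.1 p.2 : T)).
Proof.
move=> ca [m x] U /= /(ca m x) aU.
exists ([set m], a m @^-1` U) => /=; first by split => //=; exact: discrete_set1.
by move=> [m' x'] /= [-> ?].
Qed.

Lemma act_continuous1 (M : monoidType) (X : mspaceType M) (m : M) :
  continuous (act m : X -> X).
Proof.
move=> x U /= aU; have := @act_continuous M X (m, x) U aU.
case=> -[A B] /= [Am Bx] AB; apply: filterS Bx => y By.
by apply: (AB (m, y)); split => //=; exact: (@nbhs_singleton (discrete_topology M)).
Qed.

Definition trivial_action (M : monoidType) (T : Type) : Type := T.

HB.instance Definition _ (M : monoidType) (T : choiceType) :=
  Choice.copy (trivial_action M T) T.
HB.instance Definition _ (M : monoidType) (T : topologicalType) :=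
  Topological.copy (trivial_action M T) T.
HB.instance Definition _ (M : monoidType) (T : choiceType) :=
  @isMSet.Build M (trivial_action M T) (fun _ x => x)
    (fun _ => erefl) (fun _ _ _ => erefl).
HB.instance Definition _ (M : monoidType) (T : topologicalType) :=
  @isMSpace.Build M (trivial_action M T)
    (@act_continuousW M (trivial_action M T) act (fun _ _ _ aU => aU)).

HB.instance Definition _ (M : monoidType) (P : msetType M) :=
  MSet.copy (discrete_topology P) P.

Lemma discrete_act_continuous (M : monoidType) (P : msetType M) (m : M) :
  continuous (act m : discrete_topology P -> discrete_topology P).
Proof.
move=> x U /nbhs_singleton aU.
by apply: (filterS _ (@discrete_set1 (discrete_topology P) x)) => y ->.
Qed.

HB.instance Definition _ (M : monoidType) (P : msetType M) :=
  @isMSpace.Build M (discrete_topology P)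
    (act_continuousW (@discrete_act_continuous M P)).

Section product.
Context (M : monoidType).

Definition prod_act (X Y : msetType M) (m : M) (p : X * Y) : X * Y :=
  (act m p.1, act m p.2).

Lemma prod_act1 (X Y : msetType M) (p : X * Y) : prod_act 1%g p = p.
Proof. by case: p => x y; rewrite /prod_act !act1. Qed.

Lemma prod_actM (X Y : msetType M) (m n : M) (p : X * Y) :
  prod_act (m * n)%g p = prod_act m (prod_act n p).
Proof. by rewrite /prod_act !actM. Qed.

HB.instance Definition _ (X Y : msetType M) :=
  @isMSet.Build M (X * Y)%type (@prod_act X Y)
    (@prod_act1 X Y) (@prod_actM X Y).

Lemma prod_act_continuous (X Y : mspaceType M) (m : M) :
  continuous (act m : X * Y -> X * Y).
Proof.
move=> [x y] U [[A B] [/= Ax By] AB].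
exists (act m @^-1` A, act m @^-1` B) => /=.
  by split; [exact: act_continuous1 Ax | exact: act_continuous1 By].
by move=> [x' y'] [/= ? ?]; exact: AB.
Qed.

HB.instance Definition _ (X Y : mspaceType M) :=
  @isMSpace.Build M (X * Y)%type (act_continuousW (@prod_act_continuous X Y)).

End product.

Definition projective (M : monoidType) (P : msetType M) : Prop :=
  forall (E : msetType M) (p : equivariantType E P),
    (forall y, exists x, p x = y) ->
    exists s : equivariantType P E, cancel s p.

(* M-homeomorphisms *)
Definition mspace_iso (M : monoidType) (X Y : mspaceType M)
    (f : {mmap X -> Y}) : Prop :=
  exists g : {mmap Y -> X}, cancel f g /\ cancel g f.

Definition is_pushout (M : monoidType) (A B C D : mspaceType M)
    (f : {mmap A -> B}) (g : {mmap A -> C})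
    (i : {mmap B -> D}) (j : {mmap C -> D}) : Prop :=
  i \o f =1 j \o g /\
  forall (W : mspaceType M) (u : {mmap B -> W}) (v : {mmap C -> W}),
    u \o f =1 v \o g ->
    exists h : {mmap D -> W},
      [/\ h \o i =1 u, h \o j =1 v &
          forall h' : {mmap D -> W}, h' \o i =1 u -> h' \o j =1 v -> h' =1 h].

Definition is_colimit (M : monoidType) (X : nat -> mspaceType M)
    (i : forall n, {mmap X n -> X n.+1}) (L : mspaceType M)
    (j : forall n, {mmap X n -> L}) : Prop :=
  (forall n, j n.+1 \o i n =1 j n) /\
  forall (W : mspaceType M) (u : forall n, {mmap X n -> W}),
    (forall n, u n.+1 \o i n =1 u n) ->
    exists h : {mmap L -> W},
      (forall n, h \o j n =1 u n) /\
      forall h' : {mmap L -> W}, (forall n, h' \o j n =1 u n) -> h' =1 h.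

(* I, B^n and S^(n-1) = usphere R n, both of the latter inside R^n. The norm is
   Euclidean, while `|_| on matrices is the sup norm. *)
Definition unitI (R : realType) : Type := [set t : R | 0 <= t <= 1].

Definition disk (R : realType) (n : nat) : Type :=
  [set x : 'rV[R]_n | \sum_(i < n) x 0 i ^+ 2 <= 1].

Definition usphere (R : realType) (n : nat) : Type :=
  [set x : 'rV[R]_n | \sum_(i < n) x 0 i ^+ 2 = 1].

Section cw.
Context (R : realType) (M : monoidType).

Lemma usphere_disk n (x : usphere R n) :
  val x \in [set x : 'rV[R]_n | \sum_(i < n) x 0 i ^+ 2 <= 1].
Proof. by apply/mem_set => /=; have /set_mem /= -> := valP x. Qed.

Definition disk_of_usphere n (x : usphere R n) : disk R n :=
  SigSub (usphere_disk x).

Lemma disk_of_usphere_continuous n : continuous (@disk_of_usphere n).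
Proof. by apply: continuous_comp_initial; exact: initial_continuous. Qed.

Definition cell_boundary (P : msetType M) n : mspaceType M :=
  (discrete_topology P * trivial_action M (usphere R n))%type.

Definition cell (P : msetType M) n : mspaceType M :=
  (discrete_topology P * trivial_action M (disk R n))%type.

Definition cell_incl (P : msetType M) n (p : cell_boundary P n) : cell P n :=
  (p.1, disk_of_usphere p.2).

Lemma cell_incl_continuous P n : continuous (@cell_incl P n).
Proof.
move=> [x y] U [[A B] [/= Ax By] AB].
exists (A, @disk_of_usphere n @^-1` B) => /=.
  by split => //; exact: disk_of_usphere_continuous By.
by move=> [x' y'] [/= ? ?]; exact: AB.
Qed.

HB.instance Definition _ P n :=
  isContinuous.Build _ _ (@cell_incl P n) (@cell_incl_continuous P n).
HB.instance Definition _ P n :=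
  isEquivariant.Build M _ _ (@cell_incl P n) (fun _ _ => erefl).

(* skel n is X_n and cells n is P_n; the maps skel n -> skel n.+1 are closed
   embeddings as a consequence of the pushout condition. *)
Record projective_CW_structure (X : mspaceType M) := ProjectiveCWStructure {
  cells : nat -> msetType M;
  cells_projective : forall n, projective (cells n);
  skel : nat -> mspaceType M;
  skel0 : {mmap discrete_topology (cells 0) -> skel 0};
  skel0_iso : mspace_iso skel0;
  attach : forall n, {mmap cell_boundary (cells n.+1) n.+1 -> skel n};
  skel_incl : forall n, {mmap skel n -> skel n.+1};
  char_map : forall n, {mmap cell (cells n.+1) n.+1 -> skel n.+1};
  skel_pushout : forall n, is_pushout
    (attach n) (@cell_incl (cells n.+1) n.+1) (skel_incl n) (char_map n);
  skel_to : forall n, {mmap skel n -> X};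
  skel_colimit : is_colimit skel_incl skel_to
}.

Definition CW_dimension (X : mspaceType M) (c : projective_CW_structure X)
    (d : nat) : Prop :=
  mspace_iso (skel_to c d) /\ inhabited (cells c d).

Definition CW_dimension_lt (X : mspaceType M) (c : projective_CW_structure X)
    (n : nat) : Prop :=
  exists2 d, CW_dimension c d & (d < n)%N.

End cw.

Section homotopy.
Context (R : realType).
Local Notation I := (unitI R).

Lemma unitI0_subproof : (0 : R) \in [set t : R | 0 <= t <= 1].
Proof. by apply/mem_set; rewrite /= lexx ler01. Qed.

Lemma unitI1_subproof : (1 : R) \in [set t : R | 0 <= t <= 1].
Proof. by apply/mem_set; rewrite /= lexx ler01. Qed.

Definition unitI0 : I := SigSub unitI0_subproof.
Definition unitI1 : I := SigSub unitI1_subproof.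

Lemma clampI_subproof (t : R) :
  Num.max 0 (Num.min t 1) \in [set t : R | 0 <= t <= 1].
Proof.
by apply/mem_set; rewrite /= le_max lexx ge_max ler01 ge_min lexx orbT.
Qed.

Definition clampI (t : R) : I := SigSub (clampI_subproof t).

Lemma clampI_continuous : continuous clampI.
Proof.
apply: continuous_comp_initial => t.
apply: (@continuous_max R R (cst 0) (fun t => Num.min t 1)).
  exact: cvg_cst.
by apply: (@continuous_min R R id (cst 1)); [exact: cvg_id|exact: cvg_cst].
Qed.

Lemma clampI0 (t : R) : t <= 0 -> clampI t = unitI0.
Proof.
move=> t0; apply: val_inj => /=; apply/max_idPl.
by rewrite ge_min t0.
Qed.

Lemma clampI1 (t : R) : 1 <= t -> clampI t = unitI1.
Proof. by move=> t1; apply: val_inj => /=; rewrite (min_idPr t1) (max_idPr ler01). Qed.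

Definition homotopic_rel (T X : topologicalType) (A : set T) (f g : T -> X) :=
  exists H : T * I -> X,
    [/\ continuous H, (forall s, H (s, unitI0) = f s),
        (forall s, H (s, unitI1) = g s) &
        (forall s, A s -> forall t, H (s, t) = f s)].

Section equivalence.
Context (T X : topologicalType) (A : set T).
Implicit Types f g h : T -> X.

Lemma homotopic_rel_refl f : continuous f -> homotopic_rel A f f.
Proof.
move=> cf; exists (fun p => f p.1); split => // -[s t] U fU.
by exists (f @^-1` U, setT) => /=;
  [split; [exact: cf fU|exact: filterT]|move=> [? ?] [/= ? _]].
Qed.

(* precomposition of a homotopy with a self-map of the time interval *)
Lemma retime_continuous (H : T * I -> X) (phi : R -> R) :
  continuous H -> continuous phi ->
  continuous (fun p : T * I => H (p.1, clampI (phi (val p.2)))).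
Proof.
move=> cH cphi [s t] U /(cH _) [[B C] [/= Bs Ct] BC].
exists (B, (fun t : I => clampI (phi (val t))) @^-1` C) => /=.
  split => //; suff: continuous (fun t : I => clampI (phi (val t))) by apply.
  move=> u; apply: (@continuous_comp I R I val (fun t => clampI (phi t)) u).
    exact: initial_continuous.
  by apply: continuous_comp; [exact: cphi|exact: clampI_continuous].
by move=> [s' t'] [/= ? ?]; exact: BC.
Qed.

Lemma homotopic_rel_sym f g : homotopic_rel A f g -> homotopic_rel A g f.
Proof.
move=> [H [cH H0 H1 HA]].
exists (fun p => H (p.1, clampI (1 - val p.2))); split.
- apply: (retime_continuous (phi := fun t => 1 - t)) => // t.
  by apply: cvgB; [exact: cvg_cst|exact: cvg_id].
- by move=> s /=; rewrite clampI1 ?subr0.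
- by move=> s /=; rewrite clampI0 ?subrr.
- by move=> s As t /=; rewrite !HA// -H1 HA.
Qed.

Lemma homotopic_rel_trans f g h :
  homotopic_rel A f g -> homotopic_rel A g h -> homotopic_rel A f h.
Proof.
move=> [H [cH H0 H1 HA]] [K [cK K0 K1 KA]].
pose F (p : T * I) := H (p.1, clampI (2 * val p.2)).
pose G (p : T * I) := K (p.1, clampI (2 * val p.2 - 1)).
have cF : continuous F.
  apply: (retime_continuous (phi := fun t => 2 * t)) => // t.
  by apply: cvgM; [exact: cvg_cst|exact: cvg_id].
have cG : continuous G.
  apply: (retime_continuous (phi := fun t => 2 * t - 1)) => // t.
  apply: cvgB; last exact: cvg_cst.
  by apply: cvgM; [exact: cvg_cst|exact: cvg_id].
have cv : continuous (fun p : T * I => val p.2 : R).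
  move=> p; apply: (@continuous_comp (T * I)%type I R snd val p); first exact: cvg_snd.
  exact: initial_continuous.
pose E (p : T * I) := if val p.2 <= 2^-1 then F p else G p.
have E1 p : val p.2 <= 2^-1 -> E p = F p by rewrite /E => ->.
have E2 p : 2^-1 <= val p.2 -> E p = G p.
  rewrite /E => le2; case: ifPn => // ge2.
  have -> : F p = H (p.1, unitI1).
    by rewrite /F clampI1// -ler_pdivrMl ?mulr1.
  have -> : G p = K (p.1, unitI0).
    by rewrite /G clampI0// subr_le0 -ler_pdivlMl ?mulr1.
  by rewrite H1 K0.
exists E; split.
- apply/continuous_subspace_setT.
  rewrite (_ : setT = [set p : T * I | val p.2 <= 2^-1] `|`
                      [set p : T * I | 2^-1 <= val p.2]); last first.
    apply/esym/seteqP; split => // p _ /=.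
    by case: (leP (val p.2) 2^-1) => [|/ltW]; [left|right].
  apply: withinU_continuous.
  + apply: (@closed_comp _ _ (fun p : T * I => val p.2) [set x : R | x <= 2^-1]).
      by move=> p _; exact: cv.
    exact: closed_le.
  + apply: (@closed_comp _ _ (fun p : T * I => val p.2) [set x : R | 2^-1 <= x]).
      by move=> p _; exact: cv.
    exact: closed_ge.
  + apply: (subspace_eq_continuous (f := F)); last exact: continuous_subspaceT.
    by move=> p /set_mem ple; exact/esym/E1.
  + apply: (subspace_eq_continuous (f := G)); last exact: continuous_subspaceT.
    by move=> p /set_mem ple; exact/esym/E2.
- move=> s; rewrite E1 /= ?invr_ge0//.
  by rewrite /F /= clampI0 ?mulr0.
- move=> s; rewrite E2 /= ?invf_le1 ?ler1n//.
  by rewrite /G /= clampI1 ?mulr1// lerBrDl.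
- move=> s As t; have fg : f s = g s by rewrite -H1 HA.
  by rewrite /E /F /G; case: ifP; rewrite ?HA// KA.
Qed.

End equivalence.

Lemma homotopic_rel_comp (T X Y : topologicalType) (A : set T) (k : X -> Y)
    (f g : T -> X) :
  continuous k -> homotopic_rel A f g -> homotopic_rel A (k \o f) (k \o g).
Proof.
move=> ck [H [cH H0 H1 HA]]; exists (k \o H); split.
- by move=> p; apply: continuous_comp; [exact: cH|exact: ck].
- by move=> s /=; rewrite H0.
- by move=> s /=; rewrite H1.
- by move=> s As t /=; rewrite HA.
Qed.

Definition path_connected (X : topologicalType) (x y : X) : Prop :=
  exists gamma : I -> X,
    [/\ continuous gamma, gamma unitI0 = x & gamma unitI1 = y].

Lemma path_connectedP (X : topologicalType) (x y : X) :
  path_connected x y <-> @homotopic_rel (discrete_topology unit) X set0 (cst x) (cst y).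
Proof.
split=> [[c [cc c0 c1]]|[H [cH H0 H1 _]]].
  exists (c \o snd); split => // p.
  by apply: continuous_comp; [exact: cvg_snd|exact: cc].
exists (fun t => H (tt, t)); split => // t U /(cH (tt, t)) [[B C] [/= Bt Ct] BC].
by apply: filterS Ct => t' Ct'; apply: (BC (tt, t')); split => //=;
  exact: (@nbhs_singleton (discrete_topology unit)).
Qed.

Section pi0.
Context (X : topologicalType).

Definition path_connectedb : rel X := [rel x y | `[< path_connected x y >]].

Lemma path_connectedb_refl : reflexive path_connectedb.
Proof.
move=> x; apply/asboolP/path_connectedP/homotopic_rel_refl => ?.
exact: cvg_cst.
Qed.

Lemma path_connectedb_sym : symmetric path_connectedb.
Proof.
move=> x y; apply/asboolP/asboolP;
  by move=> /path_connectedP/homotopic_rel_sym/path_connectedP.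
Qed.

Lemma path_connectedb_trans : transitive path_connectedb.
Proof.
move=> y x z /asboolP/path_connectedP xy /asboolP/path_connectedP yz.
exact/asboolP/path_connectedP/(homotopic_rel_trans xy yz).
Qed.

Canonical path_connected_equiv := EquivRel path_connectedb
  path_connectedb_refl path_connectedb_sym path_connectedb_trans.

Definition pi0 : Type := {eq_quot path_connected_equiv}.

End pi0.

Definition pi0_map (X Y : topologicalType) (f : continuousType X Y)
    (c : pi0 X) : pi0 Y :=
  \pi_(pi0 Y) (f (repr c)).

Lemma pi0_mapE (X Y : topologicalType) (f : continuousType X Y) (x : X) :
  pi0_map f (\pi_(pi0 X) x) = \pi_(pi0 Y) (f x).
Proof.
rewrite /pi0_map; apply/eqmodP/asboolP/path_connectedP.
have /eqmodP/asboolP/path_connectedP h := reprK (\pi_(pi0 X) x).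
exact: homotopic_rel_comp (@cts_fun _ _ f) h.
Qed.

Definition cube (q : nat) : Type :=
  [set s : 'rV[R]_q | forall i, 0 <= s 0 i <= 1].

Definition cube_boundary q : set (cube q) :=
  [set s : cube q | exists i : 'I_q, val s 0 i = 0 \/ val s 0 i = 1].

Section pi.
Context (q : nat) (X : topologicalType) (x : X).

(* maps (I^q, boundary of I^q) -> (X, x) *)
Definition spheroid : Type :=
  [set a : continuousType (cube q) X |
    forall s, cube_boundary s -> a s = x].

Definition spheroid_homotopic : rel spheroid :=
  [rel a b : spheroid |
    `[< homotopic_rel (@cube_boundary q) (val a) (val b) >]].

Lemma spheroid_homotopic_refl : reflexive spheroid_homotopic.
Proof. by move=> a; apply/asboolP/homotopic_rel_refl/cts_fun. Qed.

Lemma spheroid_homotopic_sym : symmetric spheroid_homotopic.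
Proof. by move=> a b; apply/asboolP/asboolP => /homotopic_rel_sym. Qed.

Lemma spheroid_homotopic_trans : transitive spheroid_homotopic.
Proof.
move=> b a c /asboolP ab /asboolP bc.
exact/asboolP/(homotopic_rel_trans ab bc).
Qed.

Canonical spheroid_equiv := EquivRel spheroid_homotopic
  spheroid_homotopic_refl spheroid_homotopic_sym spheroid_homotopic_trans.

Definition pi : Type := {eq_quot spheroid_equiv}.

End pi.

Section pi_map.
Context (q : nat) (X Y : topologicalType) (f : continuousType X Y) (x : X).

Lemma spheroid_comp_subproof (a : spheroid q x) :
  (f \o val a : continuousType (cube q) Y) \in
  [set b : continuousType (cube q) Y |
    forall s, cube_boundary s -> b s = f x].
Proof. by apply/mem_set => s /= sb; have /set_mem -> := valP a. Qed.

Definition spheroid_comp (a : spheroid q x) : spheroid q (f x) :=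
  SigSub (spheroid_comp_subproof a).

Definition pi_map (c : pi q x) : pi q (f x) :=
  \pi_(pi q (f x)) (spheroid_comp (repr c)).

Lemma pi_mapE (a : spheroid q x) :
  pi_map (\pi_(pi q x) a) = \pi_(pi q (f x)) (spheroid_comp a).
Proof.
rewrite /pi_map; apply/eqmodP/asboolP.
have /eqmodP/asboolP h := reprK (\pi_(pi q x) a).
exact: homotopic_rel_comp (@cts_fun _ _ f) h.
Qed.

End pi_map.

(* pi_0 carries no base point, so that the conditions on it are not vacuous
   when X is empty. *)
Definition pi_bijective (X Y : topologicalType) (f : continuousType X Y)
    (q : nat) : Prop :=
  if q is 0 then bijective (pi0_map f)
  else forall x : X, bijective (@pi_map q X Y f x).

Definition pi_surjective (X Y : topologicalType) (f : continuousType X Y)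
    (q : nat) : Prop :=
  if q is 0 then forall d : pi0 Y, exists c, pi0_map f c = d
  else forall (x : X) (d : pi q (f x)), exists c, pi_map f c = d.

Definition n_equivalence (n : nat) (X Y : topologicalType)
    (f : continuousType X Y) : Prop :=
  (forall q, (q < n)%N -> pi_bijective f q) /\ pi_surjective f n.

Definition weak_equivalence (X Y : topologicalType)
    (f : continuousType X Y) : Prop :=
  forall q, pi_bijective f q.

Definition M_homotopic (M : monoidType) (X Y : mspaceType M)
    (f g : {mmap X -> Y}) : Prop :=
  exists H : {mmap X * trivial_action M I -> Y},
    (forall x, H (x, unitI0) = f x) /\ (forall x, H (x, unitI1) = g x).

Definition M_homotopy_equivalence (M : monoidType) (X Y : mspaceType M)
    (f : {mmap X -> Y}) : Prop :=
  exists g : {mmap Y -> X},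
    @M_homotopic M X X (g \o f) idfun /\ @M_homotopic M Y Y (f \o g) idfun.

End homotopy.

(* Main.v *)
Require Import Defs.
From HB Require Import structures.
From mathcomp Require Import all_boot all_order all_algebra.
From mathcomp Require Import all_classical reals topology normedtype.
From mathcomp Require Import realfun ring lra.
From mathcomp Require Import generic_quotient.

(** A lift of f : X -> Z along k : Y -> Z up to homotopy is a lift of f to the
    mapping path space N of k, whose points are pairs (y, path in Z ending at
    k y). N is itself an M-space, so such a lift can be built on a projective
    M-CW complex X by the universal properties of its skeleta alone, one cell at
    a time (skel_liftS, colim_lift).

    Over the cells P x B^n the problem loses its equivariance: the projective
    M-set P is a retract of the free M-set on P, hence an equivariant solution is
    determined by a family of independent solutions over the ball
    (projective_coordinates, cell_lift). What remains is the homotopy extension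
    and lifting property of k : Y -> Z for the pair (B^n, S^(n-1)).

    This property is derived from the hypothesis on homotopy groups in three
    steps. By the homotopy extension property of the ball and a collar argument
    it is enough to deform a map from (ball, sphere) to the pair k, the
    restriction to the sphere being free to move, until it lifts to Y
    (ball_help_of_deformation). If the ball is taken to be a cylinder V x R, the
    wall and the bottom of the cylinder can be collapsed to a point
    (cylinder_collapse), after which the top is a spheroid in Y whose image is
    null homotopic. Injectivity on pi_q contracts the top in Y, and surjectivity
    on pi_(q+1) corrects the contraction (cylinder_deformation).

    Applied to the identity of Z, lifting yields an equivariant g with k g
    homotopic to the identity. Cells can be lifted along g as well: extend the
    boundary values by homotopy extension in Z, then compare in Y by means of k,
    on cells that are one dimension higher (section_deformation). So g also has a
    right inverse k' up to homotopy, and g k ~ g k g k' ~ g k' ~ 1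
    (two_sided_inverse). The cells of dimension m of Y require pi_(m+1) of k to
    be surjective, which is why the dimensions must be smaller than n. *)

Set Implicit Arguments.
Unset Strict Implicit.
Unset Printing Implicit Defensive.

Import Order.TTheory GRing.Theory Num.Theory.
Import numFieldNormedType.Exports.

Local Open Scope classical_set_scope.
Local Open Scope quotient_scope.
Local Open Scope ring_scope.

(** * Continuity at a point *)

Section continuity.
Context {R : realType} {T : topologicalType}.
Implicit Types (V : normedModType R) (a b : T -> R) (p : T).

Lemma ct_cst (X : topologicalType) (c : X) p : continuous_at p (fun=> c).
Proof. exact: cvg_cst. Qed.

Lemma ct_add V (a b : T -> V) p : continuous_at p a ->
  continuous_at p b -> continuous_at p (fun x => a x + b x).
Proof. exact: cvgD. Qed.

Lemma ct_opp V (a : T -> V) p : continuous_at p a ->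
  continuous_at p (fun x => - a x).
Proof. exact: cvgN. Qed.

Lemma ct_mul a b p : continuous_at p a ->
  continuous_at p b -> continuous_at p (fun x => a x * b x).
Proof. exact: cvgM. Qed.

Lemma ct_inv a p : continuous_at p a -> a p != 0 ->
  continuous_at p (fun x => (a x)^-1).
Proof. by move=> ca a0; exact: cvgV. Qed.

Lemma ct_scale V a (b : T -> V) p : continuous_at p a ->
  continuous_at p b -> continuous_at p (fun x => a x *: b x).
Proof. exact: cvgZ. Qed.

Lemma ct_norm V (a : T -> V) p : continuous_at p a ->
  continuous_at p (fun x => `|a x| : R).
Proof. exact: cvg_norm. Qed.

Lemma ct_max a b p : continuous_at p a ->
  continuous_at p b -> continuous_at p (fun x => Num.max (a x) (b x)).
Proof. exact: continuous_max. Qed.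

Lemma ct_min a b p : continuous_at p a ->
  continuous_at p b -> continuous_at p (fun x => Num.min (a x) (b x)).
Proof. exact: continuous_min. Qed.

Lemma ct_sum n (a : 'I_n -> T -> R) p : (forall i, continuous_at p (a i)) ->
  continuous_at p (fun x => \sum_(i < n) a i x).
Proof.
move=> ca; elim: n a ca => [|n IHn] a ca.
  rewrite (_ : (fun x => _) = fun=> 0); first exact: cvg_cst.
  by apply/funext => x; rewrite big_ord0.
rewrite (_ : (fun x => _) = fun x =>
    \sum_(i < n) a (widen_ord (leqnSn n) i) x + a ord_max x).
  by apply: ct_add => //; exact: IHn.
by apply/funext => x; rewrite big_ord_recr.
Qed.

Lemma ct_pair (X Y : topologicalType) (a : T -> X) (b : T -> Y) p :
  continuous_at p a -> continuous_at p b ->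
  continuous_at p (fun x => (a x, b x)).
Proof. exact: cvg_pair. Qed.

Lemma ct_fst (X Y : topologicalType) (a : T -> X * Y) p :
  continuous_at p a -> continuous_at p (fun x => (a x).1).
Proof. by move=> ca; exact: (continuous_comp ca (@cvg_fst _ _ _ _ _)). Qed.

Lemma ct_snd (X Y : topologicalType) (a : T -> X * Y) p :
  continuous_at p a -> continuous_at p (fun x => (a x).2).
Proof. by move=> ca; exact: (continuous_comp ca (@cvg_snd _ _ _ _ _)). Qed.

Lemma ct_comp (X Y : topologicalType) (f : X -> Y) (a : T -> X) p :
  continuous_at (a p) f -> continuous_at p a ->
  continuous_at p (fun x => f (a x)).
Proof. by move=> cf ca; exact: (continuous_comp ca cf). Qed.

Lemma ct_val (X : topologicalType) (A : set X) (a : T -> A) p :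
  continuous_at p a -> continuous_at p (fun x => val (a x)).
Proof.
move=> ca; apply: (@ct_comp _ _ (val : A -> X)) => //.
exact: initial_continuous.
Qed.

Lemma ct_id p : continuous_at p (fun x : T => x).
Proof. exact: cvg_id. Qed.

(** Gluing along a zero set: only the value at the point under consideration has
    to match, so the pieces may be discontinuous elsewhere. *)
Lemma ct_paste (X : topologicalType) (a : T -> R) (f g : T -> X) p :
  continuous_at p a ->
  (a p <= 0 -> continuous_at p f) -> (0 <= a p -> continuous_at p g) ->
  (a p = 0 -> f p = g p) ->
  continuous_at p (fun x => if a x <= 0 then f x else g x).
Proof.
move=> ca cf cg fg U; rewrite /continuous_at /= => Up.
change (nbhs p ((fun x => if a x <= 0 then f x else g x) @^-1` U)).
move: Up.
have [ap|ap|ap] := ltgtP (a p) 0.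
- move=> fU; have {}fU : nbhs p (f @^-1` U) by apply: cf fU; exact: ltW.
  have aneg : \forall x \near p, a x < 0 by apply: (cvgr_lt (a p)).
  have : nbhs p ((f @^-1` U) `&` [set x | a x < 0]) by exact: filterI.
  by apply: filterS => x [/= ? /ltW ->].
- move=> gU; have {}gU : nbhs p (g @^-1` U) by apply: cg gU; exact: ltW.
  have apos : \forall x \near p, 0 < a x by apply: (cvgr_gt (a p)).
  have : nbhs p ((g @^-1` U) `&` [set x | 0 < a x]) by exact: filterI.
  by apply: filterS => x [/= ? ax]; rewrite leNgt ax.
- move=> Uf; have gU : nbhs p (g @^-1` U) by apply: cg; rewrite ?ap// -fg.
  have fU : nbhs p (f @^-1` U) by apply: cf; rewrite ?ap.
  have : nbhs p ((f @^-1` U) `&` (g @^-1` U)) by exact: filterI.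
  by apply: filterS => x [/= ? ?]; case: ifP.
Qed.

Lemma ct_mx n (f : T -> 'rV[R]_n) (p : T) :
  (forall i, continuous_at p (fun x => f x 0 i)) -> continuous_at p f.
Proof.
move=> cf U [P /= Pf PU].
have : nbhs p [set x | forall i, P 0 i (f x 0 i)].
  have : \forall x \near p, forall i : 'I_n, P 0 i (f x 0 i).
    by apply: filter_forall => i; exact: (cf i _ (Pf 0 i)).
  by [].
by apply: filterS => x Px; apply: PU => i j /=; rewrite ord1.
Qed.

Lemma ct_coord n (f : T -> 'rV[R]_n) i (p : T) :
  continuous_at p f -> continuous_at p (fun x => f x 0 i).
Proof.
move=> cf; apply: (@ct_comp _ _ (fun M : 'rV[R]_n => M 0 i)) => //.
exact: coord_continuous.
Qed.

End continuity.

Lemma ct_sub (T X : topologicalType) (A : set X) (a : T -> A) (p : T) :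
  continuous_at p (fun x => val (a x)) -> continuous_at p a.
Proof.
move=> ca U; rewrite nbhsE => -[B [[O oO OB] Bp] BU].
have : nbhs p ((fun x => val (a x)) @^-1` O).
  by apply: ca; apply: open_nbhs_nbhs; split=> //; move: Bp; rewrite -OB.
by apply: filterS => x Ox; apply: BU; rewrite -OB.
Qed.

Lemma ct_near (T X : topologicalType) (a b : T -> X) (p : T) :
  (\forall x \near p, a x = b x) -> continuous_at p b -> continuous_at p a.
Proof.
move=> ab cb U; rewrite (nbhs_singleton ab) => /cb bU.
have {}bU : nbhs p (b @^-1` U) by [].
have : nbhs p ([set x | a x = b x] `&` (b @^-1` U)) by exact: filterI.
by apply: filterS => x [/= -> ].
Qed.

Lemma ct_discrete (S T W : topologicalType) (P : choiceType) (F : P -> T -> W)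
    (a : S -> discrete_topology P) (b : S -> T) (s : S) :
  continuous_at s a -> continuous_at s b -> continuous_at (b s) (F (a s)) ->
  continuous_at s (fun x => F (a x) (b x)).
Proof.
move=> ca cb cF; apply: (@ct_near _ _ _ (fun x => F (a s) (b x))); last first.
  exact: (@ct_comp _ _ _ (F (a s))).
have : nbhs s (a @^-1` [set a s]) by apply: ca; exact: discrete_set1.
by apply: filterS => x /= ->.
Qed.

(* Structural search for continuity of real and vector valued expressions; the
   inverses and the abstract maps met on the way are left as subgoals. *)
Ltac ctn :=
  first
  [ lazymatch goal with |- continuous_at _ (fun x => ?c) =>
      let d := constr:(c) in refine (@ct_cst _ _ _ _) end
  | lazymatch goal with
    | |- continuous_at _ (fun x => x) => refine (@ct_id _ _)
    | |- continuous_at _ (fun x => (@?a x, @?b x)) =>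
      apply: (@ct_pair _ _ _ a b); ctn
    | |- continuous_at _ (fun x => (@?a x).1) => apply: (@ct_fst _ _ _ a); ctn
    | |- continuous_at _ (fun x => (@?a x).2) => apply: (@ct_snd _ _ _ a); ctn
    | |- continuous_at _ (fun x => @?a x *: @?b x) =>
      apply: (@ct_scale _ _ _ a b); ctn
    | |- continuous_at _ (fun x => `|@?a x|) => apply: (@ct_norm _ _ _ a); ctn
    | |- continuous_at _ (fun x => Num.max (@?a x) (@?b x)) =>
      apply: (@ct_max _ _ a b); ctn
    | |- continuous_at _ (fun x => Num.min (@?a x) (@?b x)) =>
      apply: (@ct_min _ _ a b); ctn
    | |- continuous_at _ (fun x => @?a x * @?b x) =>
      apply: (@ct_mul _ _ a b); ctn
    | |- continuous_at _ (fun x => @?a x + @?b x) =>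
      apply: (@ct_add _ _ _ a b); ctn
    | |- continuous_at _ (fun x => - @?a x) => apply: (@ct_opp _ _ _ a); ctn
    | |- continuous_at _ (fun x => (@?a x)^-1) => apply: (@ct_inv _ _ a); [ctn|]
    | |- continuous_at _ (fun x => fun_of_matrix (@?a x) 0 ?i) =>
      apply: (@ct_coord _ _ _ a i); ctn
    | |- continuous_at _ (fun x => @isSub.val_subdef _ _ _ _ (@?a x)) =>
      apply: (@ct_val _ _ _ a); ctn
    | |- continuous_at _ (fun x => ?h x) => idtac
    | |- continuous_at _ (fun x => ?h (@?a x)) =>
      apply: (@ct_comp _ _ _ h a); [|ctn]
    | |- _ => idtac
    end ];
  try done.

(** * Maps on balls and spheres *)

(** Maps on the unit ball of V are represented by continuous maps on V, maps on
    its unit sphere by maps on V that are continuous away from 0; only the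
    values at vectors of norm at most 1, resp. equal to 1, are meaningful. *)

Section ball.
Context {R : realType}.

Definition clamp01 (t : R) : R := Num.max 0 (Num.min t 1).

Lemma clamp01_ge0 t : 0 <= clamp01 t.
Proof. by rewrite le_max lexx. Qed.

Lemma clamp01_le1 t : clamp01 t <= 1.
Proof. by rewrite ge_max ler01 ge_min lexx orbT. Qed.

Lemma clamp01_id t : 0 <= t <= 1 -> clamp01 t = t.
Proof. by move=> /andP[t0 t1]; rewrite /clamp01 min_l// max_r. Qed.

Lemma clamp01_0 : clamp01 0 = 0. Proof. by rewrite clamp01_id ?lexx ?ler01. Qed.
Lemma clamp01_1 : clamp01 1 = 1. Proof. by rewrite clamp01_id ?lexx ?ler01. Qed.

Context (V : normedModType R).
Implicit Types (x : V) (s t : R).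

Definition sphere_map (X : topologicalType) (g : V -> X) :=
  forall x, x != 0 -> continuous_at x g.

Definition sphere_homotopy (X : topologicalType) (h : V * R -> X) :=
  forall p, p.1 != 0 -> continuous_at p h.

Lemma ball_normalize (m : R) x :
  0 < m -> `|x| <= m -> `|m^-1 *: x| <= 1.
Proof.
move=> m0 xm; rewrite normrZ normfV (gtr0_norm m0) mulrC ler_pdivrMr//.
by rewrite mul1r.
Qed.

Lemma sphere_normalize x : x != 0 -> `| `|x|^-1 *: x| = 1.
Proof. by move=> x0; rewrite normrZ normfV normr_id mulVf// normr_eq0. Qed.

Lemma sphere_neq0 x : `|x| = 1 -> x != 0.
Proof. by move=> x1; rewrite -normr_eq0 x1 oner_neq0. Qed.

Lemma continuous_section (X : topologicalType) (H : V * R -> X) t :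
  continuous H -> continuous (fun x => H (x, t)).
Proof. by move=> cH x; ctn; exact: cH. Qed.

(** The homotopy extension property of the ball relative to its sphere. The
    cylinder retracts onto its base and wall by central projection from the
    point at height 2 above the centre; m is the scaling factor of that
    projection. *)
Lemma ball_hep (X : topologicalType) (f : V -> X) (h : V * R -> X) :
  continuous f -> sphere_homotopy h -> (forall x, `|x| = 1 -> h (x, 0) = f x) ->
  exists H : V * R -> X, [/\ continuous H,
    forall x, `|x| <= 1 -> H (x, 0) = f x &
    forall x t, `|x| = 1 -> 0 <= t <= 1 -> H (x, t) = h (x, t)].
Proof.
move=> cf ch hf.
pose m (p : V * R) := Num.max (1 - clamp01 p.2 / 2) `|p.1|.
have m_gt0 p : 0 < m p.
  by rewrite lt_max; apply/orP; left; have := clamp01_le1 p.2; lra.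
have m_neq0 p : m p != 0 by exact: lt0r_neq0.
exists (fun p => if `|p.1| - (1 - clamp01 p.2 / 2) <= 0 then f ((m p)^-1 *: p.1)
  else h ((m p)^-1 *: p.1, 2 - (2 - clamp01 p.2) / m p)); split.
- move=> p; apply: ct_paste.
  + rewrite /clamp01; ctn.
  + by move=> _; rewrite /m /clamp01; ctn; exact: m_neq0.
  + move=> ap; rewrite /m /clamp01; ctn; try exact: m_neq0.
    apply: ch => /=; apply: contraTneq ap => /eqP.
    rewrite scaler_eq0 invr_eq0 (negbTE (m_neq0 p)) /= => /eqP ->.
    by rewrite normr0 -ltNge; have := clamp01_le1 p.2; lra.
  + move=> ap.
    have mE : m p = `|p.1| by apply/max_idPr; lra.
    have p0 : p.1 != 0 by rewrite -normr_eq0 -mE.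
    rewrite mE -hf ?sphere_normalize//; congr (h (_, _)).
    have -> : 2 - clamp01 p.2 = 2 * `|p.1| by lra.
    by rewrite mulfK ?subrr// normr_eq0.
- move=> x x1 /=; rewrite /m /= clamp01_0 mul0r subr0 subr_le0 x1.
  by rewrite (max_idPl x1) invr1 scale1r.
- move=> x t x1 t01 /=; rewrite /m /= clamp01_id// x1.
  have -> : Num.max (1 - t / 2) 1 = 1 by apply/max_idPr; lra.
  rewrite invr1 scale1r mulr1; case: ifP => t0; last by congr (h (_, _)); lra.
  by rewrite -hf//; congr (h (_, _)); lra.
Qed.

Context (Y Z : topologicalType) (k : Y -> Z).

(** HELP, the homotopy extension and lifting property of k, for the pair
    (ball, sphere). *)
Definition ball_help :=
  forall (f : V -> Z) (g : V -> Y) (h : V * R -> Z),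
  continuous f -> sphere_map g -> sphere_homotopy h ->
  (forall x, `|x| = 1 -> h (x, 0) = f x) ->
  (forall x, `|x| = 1 -> h (x, 1) = k (g x)) ->
  exists (g' : V -> Y) (h' : V * R -> Z), continuous g' /\ continuous h' /\
   [/\ forall x, `|x| = 1 -> g' x = g x,
       forall x t, `|x| = 1 -> 0 <= t <= 1 -> h' (x, t) = h (x, t),
       forall x, `|x| <= 1 -> h' (x, 0) = f x &
       forall x, `|x| <= 1 -> h' (x, 1) = k (g' x)].

Definition pair_map (F : V -> Z) (g : V -> Y) :=
  [/\ continuous F, sphere_map g & forall x, `|x| = 1 -> F x = k (g x)].

(** Homotopy of maps from (ball, sphere) to the pair k : Y -> Z; the restriction
    to the sphere is allowed to move. *)
Definition pair_homotopic (F : V -> Z) (g : V -> Y)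
    (F' : V -> Z) (g' : V -> Y) :=
  exists (H : V * R -> Z) (h : V * R -> Y), continuous H /\ sphere_homotopy h /\
   [/\ forall x, `|x| <= 1 -> H (x, 0) = F x,
       forall x, `|x| <= 1 -> H (x, 1) = F' x,
       forall x, `|x| = 1 -> h (x, 0) = g x,
       forall x, `|x| = 1 -> h (x, 1) = g' x &
       forall x t, `|x| = 1 -> 0 <= t <= 1 -> H (x, t) = k (h (x, t))].

Lemma ball_normalize1 x : `| (Num.max 1 `|x|)^-1 *: x| <= 1.
Proof.
apply: ball_normalize; last by rewrite le_max lexx orbT.
by rewrite lt_max ltr01.
Qed.

Lemma ball_normalize_id x : `|x| <= 1 -> (Num.max 1 `|x|)^-1 *: x = x.
Proof. by move=> x1; rewrite (max_idPl x1) invr1 scale1r. Qed.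

Lemma sphere_normalize_id x : `|x| = 1 -> `|x|^-1 *: x = x.
Proof. by move=> ->; rewrite invr1 scale1r. Qed.

Lemma max1_neq0 x : Num.max 1 `|x| != 0.
Proof. by apply/lt0r_neq0; rewrite lt_max ltr01. Qed.

Lemma pair_homotopic_trans F g F' g' F'' g'' :
  pair_homotopic F g F' g' -> pair_homotopic F' g' F'' g'' ->
  pair_homotopic F g F'' g''.
Proof.
move=> [H [h [cH [ch [H0 H1 h0 h1 Hh]]]]] [K [l [cK [cl [K0 K1 l0 l1 Kl]]]]].
pose b x := (Num.max 1 `|x|)^-1 *: x; pose s x := `|x|^-1 *: x : V.
have cb x : continuous_at x b by rewrite /b; ctn; exact: max1_neq0.
have cs x : x != 0 -> continuous_at x s.
  by move=> x0; rewrite /s; ctn; rewrite normr_eq0.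
have s0 x : x != 0 -> s x != 0.
  by move=> x0; rewrite scaler_eq0 invr_eq0 normr_eq0 (negbTE x0).
exists (fun p => if 2 * p.2 - 1 <= 0 then H (b p.1, 2 * p.2)
                 else K (b p.1, 2 * p.2 - 1)).
exists (fun p => if 2 * p.2 - 1 <= 0 then h (s p.1, 2 * p.2)
                 else l (s p.1, 2 * p.2 - 1)).
split; [|split; [|split]].
- move=> p; apply: ct_paste; first by ctn.
  + by move=> _; ctn; exact: cH.
  + by move=> _; ctn; exact: cK.
  + move=> p2; have -> : 2 * p.2 = 1 by lra.
    by rewrite subrr H1 ?K0//; exact: ball_normalize1.
- move=> p p0; apply: ct_paste; first by ctn.
  + by move=> _; ctn; [apply: ch; exact: s0|exact: cs].
  + by move=> _; ctn; [apply: cl; exact: s0|exact: cs].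
  + move=> p2; have -> : 2 * p.2 = 1 by lra.
    by rewrite subrr h1 ?l0//; exact: sphere_normalize.
- move=> x x1 /=; rewrite mulr0 ifT; last by lra.
  by rewrite /b ball_normalize_id ?H0.
- move=> x x1 /=; rewrite ifF; last by apply/negbTE; rewrite -ltNge; lra.
  by rewrite /b ball_normalize_id// -K1//; congr (K (_, _)); lra.
- move=> x x1 /=; rewrite mulr0 ifT; last by lra.
  by rewrite /s sphere_normalize_id ?h0.
- move=> x x1 /=; rewrite ifF; last by apply/negbTE; rewrite -ltNge; lra.
  by rewrite /s sphere_normalize_id// -l1//; congr (l (_, _)); lra.
- move=> x t x1 /andP[t0 t1] /=.
  rewrite /s /b sphere_normalize_id// ball_normalize_id ?x1//.
  case: ifPn => [?|]; first by rewrite Hh//; lra.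
  by rewrite -ltNge => ?; rewrite Kl//; lra.
Qed.

(** A homotopy whose track on the sphere is not the prescribed one can be
    corrected by squeezing the unwanted part of the track into a collar. The
    prescribed homotopy h and the pair homotopy are performed one after the
    other, during the times [-1,0] and [0,1]; stage s of the new homotopy sends
    x to x / max(1-s/2,|x|) and to the time min(2s-1, s-1+2(1-|x|)). On the
    sphere this time is s-1, so that only h is seen there; for s = 1 it reaches 1
    on the inner half of the ball. *)
Lemma ball_help_of_deformation : continuous k ->
  (forall F g, pair_map F g ->
    exists2 g', continuous g' & pair_homotopic F g (k \o g') g') ->
  ball_help.
Proof.
move=> ck def f g h cf cg ch hf hg.
have [P [cP P0 P1]] := ball_hep cf ch hf.
pose F x := P (x, 1).
have [|g' cg' [H [l [cH [cl [H0 H1 l0 l1 Hl]]]]]] := def F g.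
  split=> //; first exact: continuous_section.
  by move=> x x1; rewrite /F P1 ?hg ?lexx ?ler01.
pose m (p : V * R) := Num.max (1 - clamp01 p.2 / 2) `|p.1|.
pose T (p : V * R) :=
  Num.min (2 * clamp01 p.2 - 1) (clamp01 p.2 - 1 + 2 * (1 - `|p.1|)).
have m_gt0 p : 0 < m p.
  by rewrite lt_max; apply/orP; left; have := clamp01_le1 p.2; lra.
have m_neq0 p : m p != 0 by exact: lt0r_neq0.
have cm p : continuous_at p m by rewrite /m /clamp01; ctn.
have cT p : continuous_at p T by rewrite /T /clamp01; ctn.
pose b p := (m p)^-1 *: p.1.
have b1 p : `|b p| <= 1 by apply: ball_normalize; rewrite // le_max lexx orbT.
have cb p : continuous_at p b by rewrite /b; ctn; exact: m_neq0.
pose G x := if `|x| - 2^-1 <= 0 then g' (2 *: x)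
            else l (`|x|^-1 *: x, 2 * (1 - `|x|)).
have xh (x : V) : 0 <= `|x| - 2^-1 -> x != 0.
  by move=> xh; rewrite -normr_eq0; apply/lt0r_neq0; lra.
exists G, (fun p => if T p <= 0 then P (b p, 1 + T p) else H (b p, T p)).
split; [|split; [|split]].
- move=> x; apply: ct_paste; first by ctn.
  + by move=> _; ctn; exact: cg'.
  + move=> /xh x0; ctn; try by rewrite normr_eq0.
    by apply: cl; rewrite /= scaler_eq0 invr_eq0 normr_eq0 (negbTE x0).
  + move=> xh'; have xE : `|x| = 2^-1 by lra.
    rewrite xE invrK (_ : 2 * (1 - 2^-1) = 1); last by lra.
    by rewrite l1// normrZ xE gtr0_norm//; lra.
- move=> p; apply: ct_paste => //.
  + by move=> _; ctn; exact: cP.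
  + by move=> _; ctn; exact: cH.
  + by move=> ->; rewrite addr0 H0.
- move=> x x1; rewrite /G x1 ifF; last by apply/negbTE; rewrite -ltNge; lra.
  by rewrite subrr mulr0 invr1 scale1r l0.
- move=> x t x1 t01; have /andP[t0 t1] := t01.
  have -> : T (x, t) = t - 1.
    by rewrite /T /= x1 clamp01_id// subrr mulr0 addr0; apply/min_idPr; lra.
  have -> : b (x, t) = x.
    rewrite /b /m /= x1 (_ : Num.max _ _ = 1) ?invr1 ?scale1r//.
    by apply/max_idPr; rewrite clamp01_id//; lra.
  rewrite ifT; last by lra.
  by rewrite P1//; [congr (h (_, _)); lra | lra].
- move=> x x1; have -> : T (x, 0) = -1.
    by rewrite /T /= clamp01_0 min_l; lra.
  have -> : b (x, 0) = x.
    rewrite /b /m /= clamp01_0 mul0r subr0; exact: ball_normalize_id.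
  by rewrite ifT ?subrr ?P0//; lra.
- move=> x x1; rewrite /G /T /b /m /= clamp01_1.
  have [xle|xgt] := leP `|x| (2^-1).
    rewrite [in RHS]ifT; last by lra.
    have -> : Num.max (1 - 1 / 2) `|x| = 2^-1 by rewrite max_l; lra.
    have -> : Num.min (2 * 1 - 1) (1 - 1 + 2 * (1 - `|x|)) = 1.
      by rewrite min_l; lra.
    rewrite ifF; last by apply/negbTE; rewrite -ltNge.
    by rewrite invrK H1// normrZ gtr0_norm//; lra.
  rewrite [in RHS]ifF; last by apply/negbTE; rewrite -ltNge; lra.
  have -> : Num.max (1 - 1 / 2) `|x| = `|x| by rewrite max_r//; lra.
  have -> : Num.min (2 * 1 - 1) (1 - 1 + 2 * (1 - `|x|)) = 2 * (1 - `|x|).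
    by rewrite min_r; lra.
  have y1 : `| `|x|^-1 *: x| = 1.
    by apply: sphere_normalize; apply: xh; lra.
  case: ifPn => [Tle|]; last by rewrite -ltNge => ?; rewrite Hl//; lra.
  have x1' : `|x| = 1 by lra.
  rewrite x1' subrr mulr0 addr0 invr1 scale1r l0//.
  by rewrite P1 ?hg ?lexx ?ler01.
Qed.

End ball.

(** * Lifting over cells *)

Section based.
Context {R : realType} (V : normedModType R).
Context (Y Z : topologicalType) (k : Y -> Z).

(** Injectivity, resp. surjectivity, of k on based homotopy classes of maps
    (ball, sphere) -> (Y, y0), comparing with the constant map only. *)
Definition based_injective :=
  forall (y0 : Y) (b : V -> Y) (K : V * R -> Z),
  continuous b -> continuous K -> (forall x, `|x| = 1 -> b x = y0) ->
  (forall x, `|x| <= 1 -> K (x, 0) = k y0) ->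
  (forall x, `|x| <= 1 -> K (x, 1) = k (b x)) ->
  (forall x t, `|x| = 1 -> 0 <= t <= 1 -> K (x, t) = k y0) ->
  exists G : V * R -> Y, continuous G /\
   [/\ forall x, `|x| <= 1 -> G (x, 0) = y0,
       forall x, `|x| <= 1 -> G (x, 1) = b x &
       forall x t, `|x| = 1 -> 0 <= t <= 1 -> G (x, t) = y0].

Definition based_surjective :=
  forall (y0 : Y) (d : V -> Z),
  continuous d -> (forall x, `|x| = 1 -> d x = k y0) ->
  exists (a : V -> Y) (D : V * R -> Z), continuous a /\ continuous D /\
   [/\ forall x, `|x| = 1 -> a x = y0,
       forall x, `|x| <= 1 -> D (x, 0) = d x,
       forall x, `|x| <= 1 -> D (x, 1) = k (a x) &
       forall x t, `|x| = 1 -> 0 <= t <= 1 -> D (x, t) = k y0].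

End based.

Section cylinder.
Context {R : realType} (V : normedModType R).
Context (Y Z : topologicalType) (k : Y -> Z).
Let W : normedModType R := (V * R)%type.

Lemma norm_cylinder (w : W) : `|w| = Num.max `|w.1| `|w.2|.
Proof. exact: prodnormedzmodule.ProdNormedZmodule.prod_normE. Qed.

Lemma cylinder_ball (x : V) (s : R) :
  `|(x, s) : W| <= 1 <-> `|x| <= 1 /\ -1 <= s <= 1.
Proof.
rewrite norm_cylinder ge_max /= ler_norml.
by split=> [/andP[]|[-> ->]].
Qed.

(** The sphere of V x R is the union of a wall, a top and a bottom. *)
Lemma cylinder_sphere (x : V) (s : R) : `|(x, s) : W| = 1 <->
  [/\ `|x| <= 1, -1 <= s <= 1 & [\/ `|x| = 1, s = -1 | s = 1]].
Proof.
rewrite norm_cylinder /=; split.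
- move=> m1.
  have x1 : `|x| <= 1 by rewrite -m1 le_max lexx.
  have s1 : `|s| <= 1 by rewrite -m1 le_max lexx orbT.
  split=> //; first by rewrite -ler_norml.
  have [xs|xs] := leP `|x| `|s|; last by constructor 1; rewrite -m1 max_l// ltW.
  have : `|s| = 1 by rewrite -m1 max_r.
  have [s0|s0] := leP 0 s; first by rewrite ger0_norm// => ->; constructor 3.
  by rewrite ltr0_norm// => ?; constructor 2; lra.
- move=> [x1 /andP[s0 s1] c]; have sle : `|s| <= 1 by rewrite ler_norml s0.
  case: c => [->|->|->]; rewrite ?normrN ?normr1; first exact: max_l.
    exact: max_r.
  exact: max_r.
Qed.

(** The wall and the bottom together form a ball, so the sphere of V x R can be
    deformed until they have become a single point, the rest of the sphere being
    covered by the top. Here this is done by normalizing the segment from the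
    identity to f; the last two entries of m make the formula extend over the
    interior and start at the identity. *)
Lemma cylinder_collapse F g : pair_map (V := W) k F g ->
  exists F' g' y0, [/\ pair_map k F' g', pair_homotopic k F g F' g' &
    forall x s, `|(x, s) : W| = 1 -> `|x| = 1 \/ s = -1 -> g' (x, s) = y0].
Proof.
move=> [cF cg Fg].
pose f (w : W) : W :=
  (((1 - `|w.1|) * (1 + w.2)) *: w.1, Num.min w.2 (1 - 2 * `|w.1|)).
pose l (p : W * R) : W := (1 - clamp01 p.2) *: p.1 + clamp01 p.2 *: f p.1.
pose m (p : W * R) :=
  Num.max `|l p| (Num.max (1 - `|p.1|) (1 - 2 * clamp01 p.2)).
pose u (p : W * R) : W := (m p)^-1 *: l p.
have cl p : continuous_at p l by rewrite /l /f /clamp01; ctn.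
have cm p : continuous_at p m by rewrite /m /clamp01; ctn.
(* On the sphere the segment avoids 0 and the first entry of m dominates. *)
have lS (w : W) t : `|w| = 1 ->
    0 < `|l (w, t)| /\ 1 - 2 * clamp01 t <= `|l (w, t)|.
  case: w => x s /cylinder_sphere [x1 /andP[s0 s1] xs].
  have := clamp01_ge0 t; have := clamp01_le1 t; rewrite /l /f /=.
  move: (clamp01 t) => {}t t1 t0.
  rewrite norm_cylinder lt_max le_max /= !normr_gt0; case: xs => [xE|->|->].
  - rewrite xE subrr mul0r scale0r scaler0 addr0 min_r; last by lra.
    rewrite normrZ xE mulr1 ger0_norm; last by lra.
    split; last by apply/orP; left; lra.
    have [->|t1'] := eqVneq t 1; apply/orP; [right|left].
      by rewrite subrr scale0r add0r scale1r; apply/eqP; lra.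
    by rewrite scaler_eq0 negb_or subr_eq0 eq_sym t1' sphere_neq0.
  - rewrite min_l; last by have := normr_ge0 x; lra.
    have -> : (1 - t) *: (-1 : R) + t *: (-1 : R) = -1.
      by rewrite /GRing.scale /=; lra.
    split; first by rewrite oppr_eq0 oner_neq0 orbT.
    by apply/orP; right; rewrite normrN normr1; lra.
  - rewrite min_r; last by have := normr_ge0 x; lra.
    have -> : (1 - t) *: (1 : R) + t *: (1 - 2 * `|x|) = 1 - 2 * t * `|x|.
      by rewrite /GRing.scale /=; lra.
    split; last first.
      apply/orP; right; apply: le_trans (ler_norm _).
      by rewrite lerD2l lerN2 ler_piMr//; lra.
    have [->|x0] := eqVneq x 0.
      by rewrite normr0 !mulr0 subr0 oner_neq0 orbT.
    have [xE|x1'] := eqVneq `|x| 1.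
      rewrite xE subrr mul0r scale0r scaler0 addr0 scaler_eq0 (negbTE x0) orbF.
      have [->|t1'] := eqVneq t 1; first by apply/orP; right; apply/eqP; lra.
      by rewrite subr_eq0 eq_sym t1'.
    apply/orP; left; rewrite scalerA -scalerDl scaler_eq0 (negbTE x0) orbF.
    apply: lt0r_neq0.
    have {x1'} x1' : 0 < 1 - `|x| by rewrite subr_gt0 lt_neqAle x1'.
    by move: t0; rewrite le_eqVlt => /orP[/eqP <-|t0]; [lra|nra].
have m_gt0 (w : W) t : `|w| <= 1 -> 0 < m (w, t).
  rewrite /m le_eqVlt => /orP[/eqP w1|w1]; rewrite lt_max.
    by have [-> _] := lS w t w1.
  by apply/orP; right; rewrite lt_max subr_gt0 w1.
have u1 (w : W) t : `|w| <= 1 -> `|u (w, t)| <= 1.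
  by move=> w1; apply: ball_normalize; rewrite ?m_gt0// le_max lexx.
have uS (w : W) t : `|w| = 1 -> `|u (w, t)| = 1.
  move=> w1; have [l0 l1] := lS w t w1.
  have mE : m (w, t) = `|l (w, t)|.
    by apply/max_idPl; rewrite ge_max l1 andbT /= w1 subrr ltW.
  by rewrite /u mE sphere_normalize// -normr_gt0.
have cu p : `|p.1| <= 1 -> continuous_at p u.
  move=> p1; rewrite /u; ctn.
  by case: p p1 => w t /= p1; rewrite lt0r_neq0 ?m_gt0.
pose b (w : W) := (Num.max 1 `|w|)^-1 *: w; pose s (w : W) := `|w|^-1 *: w : W.
have cb w : continuous_at w b by rewrite /b; ctn; exact: max1_neq0.
have cs w : w != 0 -> continuous_at w s.
  by move=> w0; rewrite /s; ctn; rewrite normr_eq0.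
pose H (p : W * R) := F (u (b p.1, p.2)).
pose h (p : W * R) := g (u (s p.1, p.2)).
have cH : continuous H.
  move=> p; change (continuous_at p H); rewrite /H; ctn.
  by apply: cu; exact: ball_normalize1.
have ch : sphere_homotopy h.
  move=> p p0; rewrite /h; ctn; last exact: cs.
    by apply: cg; apply: sphere_neq0; rewrite uS// sphere_normalize.
  by apply: cu; rewrite /= sphere_normalize.
have Hh (w : W) t : `|w| = 1 -> H (w, t) = k (h (w, t)).
  move=> w1; rewrite /H /h /= /b ball_normalize_id ?w1//.
  by rewrite /s sphere_normalize_id// Fg// uS.
have u0 (w : W) : `|w| <= 1 -> u (w, 0) = w.
  move=> w1; rewrite /u /m /l /= clamp01_0 mulr0 !subr0 scale1r scale0r addr0.
  rewrite [X in Num.max _ X]max_r; last by have := normr_ge0 w; lra.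
  by rewrite max_r// invr1 scale1r.
exists (fun w => H (w, 1)), (fun w => h (w, 1)), (g (0, -1)); split.
- split; [exact: continuous_section| |by move=> w w1; rewrite Hh].
  by move=> w w0; ctn; exact: ch.
- exists H, h; do 2 (split=> //); split=> //.
  + by move=> w w1; rewrite /H /b /= ball_normalize_id// u0.
  + by move=> w w1; rewrite /h /s /= sphere_normalize_id// u0 ?w1.
  + by move=> w t w1 _; exact: Hh.
- move=> x t xt1 xt; rewrite /h /= /s sphere_normalize_id//.
  have lE : l ((x, t), 1) = (0, -1).
    move/cylinder_sphere: xt1 => [x1 /andP[t0 t1] _].
    rewrite /l /= clamp01_1 subrr scale0r add0r scale1r /f /=.
    case: xt => [->|->].
      by rewrite subrr mul0r scale0r min_r; [congr (_, _); lra|lra].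
    by rewrite subrr mulr0 scale0r min_l//; have := normr_ge0 x; lra.
  rewrite /u /m lE clamp01_1 /= xt1 subrr (_ : `|(0, -1) : W| = 1); last first.
    by rewrite norm_cylinder /= normr0 normrN normr1 max_r.
  rewrite [X in Num.max _ X]max_l; last by lra.
  by rewrite max_l// invr1 scale1r.
Qed.

(** Once the wall and the bottom are collapsed, a map F with F = k g on the
    sphere is a null homotopy of k applied to the top of g. Injectivity gives a
    null homotopy G of the top of g, surjectivity lifts the difference of F and
    k G, and running G backwards deforms F into that difference. *)
Lemma cylinder_deformation : continuous k ->
  based_injective V k -> based_surjective W k ->
  forall F g, pair_map (V := W) k F g ->
  exists2 g', continuous g' & pair_homotopic k F g (k \o g') g'.
Proof.
move=> ck inj surj F0 g0 Fg0.
have [F [g [y0 [[cF cg Fg] FF0 gy0]]]] := cylinder_collapse Fg0.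
suff [g' cg' FF'] :
    exists2 g', continuous g' & pair_homotopic k F g (k \o g') g'.
  by exists g' => //; exact: pair_homotopic_trans FF0 FF'.
have top_neq0 (x : V) (s : R) : s != 0 -> (x, s) != 0 :> W.
  by apply: contraNneq => -[_ ->].
have top1 (x : V) : `|x| <= 1 -> `|(x, 1) : W| = 1.
  by move=> x1; apply/cylinder_sphere; split=> //; [lra|constructor 3].
have bot1 (x : V) : `|x| <= 1 -> `|(x, -1) : W| = 1.
  by move=> x1; apply/cylinder_sphere; split=> //; [lra|constructor 2].
have wall1 (x : V) s : `|x| = 1 -> -1 <= s <= 1 -> `|(x, s) : W| = 1.
  by move=> x1 s1; apply/cylinder_sphere; split; rewrite ?x1//; constructor 1.
have [] := inj y0 (fun x => g (x, 1)) (fun p => F (p.1, 2 * p.2 - 1)).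
- move=> x; ctn.
  by apply: cg; exact: (top_neq0 x 1 (oner_neq0 _)).
- by move=> p; ctn.
- by move=> x x1; rewrite gy0 ?top1 ?x1//; left.
- move=> x x1 /=; rewrite mulr0 sub0r Fg ?bot1// gy0 ?bot1//; by right.
- by move=> x x1 /=; rewrite (_ : 2 * 1 - 1 = 1) ?Fg ?top1//; lra.
- move=> x t x1 t01 /=.
  have s1 : -1 <= 2 * t - 1 <= 1 by lra.
  by rewrite Fg ?wall1// gy0 ?wall1//; left.
move=> G [cG [G0 G1 Gw]].
pose b (x : V) := (Num.max 1 `|x|)^-1 *: x.
have cb x : continuous_at x b by rewrite /b; ctn; exact: max1_neq0.
have b1 x : `|b x| <= 1 by exact: ball_normalize1.
(* E runs through F for heights in [-1,1], then through k G backwards for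
   heights in [1,3]; H stretches it from [-1,1] to [-1,3]. On the sphere this is
   covered by h, which pushes the top down along G. *)
pose E (p : V * R) :=
  if p.2 - 1 <= 0 then F (b p.1, p.2) else k (G (b p.1, (3 - p.2) / 2)).
have cE : continuous E.
  move=> p; apply: ct_paste; first by ctn.
  - by move=> _; ctn.
  - by move=> _; ctn.
  - move=> p2; have -> : p.2 = 1 by lra.
    by rewrite (_ : (3 - 1) / 2 = 1) ?G1 ?Fg ?top1//; lra.
pose H (p : W * R) := E (p.1.1, (p.1.2 + 1) * (1 + p.2) - 1).
pose h (p : W * R) := G (b p.1.1, Num.max 0 ((p.1.2 + 1) / 2 - p.2)).
have cH : continuous H by move=> p; change (continuous_at p H); rewrite /H; ctn.
have ch : continuous h by move=> p; change (continuous_at p h); rewrite /h; ctn.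
have Hh (w : W) t : `|w| = 1 -> 0 <= t <= 1 -> H (w, t) = k (h (w, t)).
  case: w => x s /cylinder_sphere [x1 s1 xs] t01; rewrite /H /h /E /=.
  rewrite /b ball_normalize_id//; case: xs => [xE|sE|sE].
  - rewrite [in RHS]Gw//; last first.
      by rewrite le_max lexx ge_max ler01 /=; lra.
    case: ifPn => [sle|]; last first.
      by rewrite -ltNge => sgt; rewrite Gw//; nra.
    have u1 : -1 <= (s + 1) * (1 + t) - 1 <= 1 by nra.
    by rewrite Fg ?wall1// gy0 ?wall1//; left.
  - rewrite sE addNr !mul0r !sub0r ifT; last by lra.
    rewrite max_l ?G0//; last by lra.
    by rewrite Fg ?bot1// gy0 ?bot1//; right.
  - rewrite sE max_r; last by lra.
    case: ifPn => [sle|]; last first.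
      by rewrite -ltNge => sgt; congr (k (G (_, _))); lra.
    have -> : t = 0 by lra.
    have half : (1 + 1) / 2 = 1 :> R by lra.
    by rewrite addr0 mulr1 addrK subr0 half Fg ?top1// G1.
have [] := surj y0 (fun w => H (w, 1)).
- exact: continuous_section.
- move=> [x s] w1; rewrite Hh ?lexx ?ler01//; congr k.
  move/cylinder_sphere: w1 => [x1 s1 _]; rewrite /h /= max_l; last by lra.
  by rewrite G0.
move=> a [D [ca [cD [ay0 D0 D1 Dw]]]].
exists a => //.
apply: (@pair_homotopic_trans _ _ _ _ _ _ _ (fun w => H (w, 1)) (fun=> y0)).
- exists H, h; do 2 (split=> //); split=> //.
  + move=> [x s] /cylinder_ball [x1 s1]; rewrite /H /E /=.
    rewrite addr0 mulr1 addrK ifT; last by lra.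
    by rewrite /b ball_normalize_id.
  + move=> [x s] w1; move: (w1); rewrite /h /= subr0.
    move=> /cylinder_sphere [x1 s1 xs].
    rewrite /b ball_normalize_id// max_r; last by lra.
    case: xs => [xE|sE|sE].
    * by rewrite Gw ?gy0//; [left|lra].
    * by rewrite gy0//; [rewrite sE addNr mul0r G0|right].
    * by rewrite sE (_ : (1 + 1) / 2 = 1) ?G1//; lra.
  + move=> [x s] /cylinder_sphere [x1 s1 _]; rewrite /h /= max_l; last by lra.
    by rewrite G0.
- exists D, (fun=> y0); do 2 (split=> //); first by move=> p _; exact: ct_cst.
  by split=> // x x1; rewrite ay0.
Qed.

(** If k g is homotopic to the identity and cells one dimension higher can be
    lifted along k, then cells can be lifted along g: homotopy extension provides
    an extension a' of a, and F and g a' are joined by a homotopy because their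
    images under k are. On the wall the homotopy of these images runs along h and
    back again, which HELP for the cylinder absorbs. *)
Lemma section_deformation (g : Z -> Y) (h : Z * R -> Z) :
  continuous k -> continuous g -> continuous h ->
  (forall z, h (z, 0) = k (g z)) -> (forall z, h (z, 1) = z) ->
  ball_help W k -> forall F a, pair_map (V := V) g F a ->
  exists2 a', continuous a' & pair_homotopic g F a (g \o a') a'.
Proof.
move=> ck cg ch h0 h1 hk F a [cF ca Fa].
have [||| A [cA A0 Aw]] := @ball_hep _ V _ (k \o F) (fun p => h (a p.1, p.2)).
- by move=> x; apply: continuous_comp; [exact: cF|exact: ck].
- by move=> p p0; ctn; [exact: ca].
- by move=> x x1 /=; rewrite h0 -Fa.
pose b (x : V) := (Num.max 1 `|x|)^-1 *: x.
have cb x : continuous_at x b by rewrite /b; ctn; exact: max1_neq0.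
have b1 x : `|b x| <= 1 by exact: ball_normalize1.
pose a' x := A (b x, 1).
have ca' : continuous a'.
  by move=> x; change (continuous_at x a'); rewrite /a'; ctn.
have a'a x : `|x| = 1 -> a' x = a x.
  move=> x1; rewrite /a' /b ball_normalize_id ?x1//.
  by rewrite Aw ?h1 ?lexx ?ler01.
pose s (w : W) := `|w|^-1 *: w : W.
have cs w : w != 0 -> continuous_at w s.
  by move=> w0; rewrite /s; ctn; rewrite normr_eq0.
have s_wall (w : W) : w != 0 -> (s w).2 = 0 -> `|(s w).1| = 1.
  move=> w0 s0; have := sphere_normalize w0; rewrite -/(s w) norm_cylinder s0.
  by rewrite normr0 max_l.
(* On the boundary of the cylinder, Q is F at the bottom and g a' at the top. At
   time 0, P joins k F to k g a' through A and h; on the wall it passes through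
   h from k g a to a and back. As time goes on the passage is retracted until it
   is constant. *)
pose P (p : W * R) :=
  if p.1.2 <= 0 then A (b p.1.1, (1 + p.1.2) * (1 - clamp01 p.2))
  else h (a' p.1.1, (1 - p.1.2) * (1 - clamp01 p.2)).
pose Q (w : W) := if w.2 <= 0 then F (b w.1) else g (a' w.1).
have cP (p : W * R) : (p.1.2 = 0 -> `|p.1.1| = 1 \/ p.2 = 0) ->
    continuous_at p P.
  move=> p0; apply: ct_paste; first by ctn.
  - by move=> _; rewrite /clamp01; ctn.
  - by move=> _; rewrite /clamp01; ctn.
  - move=> s0; rewrite s0 addr0 subr0 !mul1r; have [x1|->] := p0 s0.
      rewrite /b ball_normalize_id ?x1// Aw//; last first.
        by have := clamp01_ge0 p.2; have := clamp01_le1 p.2; lra.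
      by rewrite a'a.
    by rewrite clamp01_0 subr0 h1.
have [] := hk (fun w => P (w, 0)) (fun w => Q (s w)) (fun p => P (s p.1, p.2)).
- move=> w; ctn.
  by apply: cP => _; right.
- move=> w w0; rewrite /Q; apply: ct_paste.
  + by ctn; exact: cs.
  + by move=> _; ctn; exact: cs.
  + by move=> _; ctn; exact: cs.
  + move=> s0; have x1 := s_wall _ w0 s0.
    by rewrite /b ball_normalize_id ?x1// a'a// Fa.
- move=> p p0; ctn; last exact: cs.
  by apply: cP => /= s0; left; exact: s_wall.
- by move=> w w1; rewrite /s /= sphere_normalize_id.
- move=> w w1; rewrite /P /Q /= clamp01_1 subrr !mulr0; case: ifP => _.
    by rewrite A0.
  by rewrite h0.
move=> Q' [P' [cQ' [cP' [Q'Q _ _ _]]]].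
exists a' => //; exists (fun p => Q' (p.1, 2 * p.2 - 1)), (fun p => a p.1).
have sQ (x : V) (t : R) : `|(x, t) : W| = 1 -> Q' (x, t) = Q (x, t).
  by move=> w1; rewrite Q'Q//= /s sphere_normalize_id.
split; [|split; [|split]].
- by move=> p; ctn.
- by move=> p p0; ctn; exact: ca.
- move=> x x1; rewrite /= mulr0 sub0r sQ; last first.
    by apply/cylinder_sphere; split=> //; [lra|constructor 2].
  by rewrite /Q /= lerN10 /b ball_normalize_id.
- move=> x x1; rewrite /= (_ : 2 * 1 - 1 = 1); last by lra.
  rewrite sQ; last by apply/cylinder_sphere; split=> //; [lra|constructor 3].
  by rewrite /Q /= ler10.
- by [].
- by move=> x x1; rewrite a'a.
- move=> x t x1 t01; rewrite /= sQ; last first.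
    by apply/cylinder_sphere; split; rewrite ?x1//; [lra|constructor 1].
  rewrite /Q /= /b ball_normalize_id ?x1//.
  by case: ifP => _; rewrite ?Fa ?a'a.
Qed.

End cylinder.

(** * Homotopy groups and cubes *)

Section row.
Context {R : realType}.

Lemma rV_norm_le n (v : 'rV[R]_n) (c : R) : 0 <= c ->
  (`|v| <= c) <-> forall i, `|v 0 i| <= c.
Proof.
move=> c0; rewrite /Num.norm /= mx_normrE; split=> [vc i|vc].
  apply: le_trans vc; exact: (le_bigmax _ (fun ij => `|v ij.1 ij.2|) (0, i)).
by apply/bigmax_leP; split=> // -[i j] _ /=; rewrite (ord1 i); exact: vc.
Qed.

Lemma rV_norm1 n (v : 'rV[R]_n) : `|v| = 1 -> exists i, `|v 0 i| = 1.
Proof.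
move=> v1; have [|[i j]] := @mx_norm_neq0 _ _ _ v.
  by change (`|v| != 0); rewrite v1 oner_neq0.
rewrite /= ord1 => vE; exists j.
by rewrite -vE; exact: v1.
Qed.

(** The unit ball of R^n for the sup norm is the cube [-1,1]^n, which is carried
    to [0,1]^n coordinate by coordinate. *)
Definition cube_of (n : nat) (v : 'rV[R]_n) : 'rV[R]_n :=
  \row_i (clamp01 ((v 0 i + 1) / 2)).

Lemma cube_of_subproof n (v : 'rV[R]_n) :
  cube_of v \in [set s : 'rV[R]_n | forall i, 0 <= s 0 i <= 1].
Proof. by apply/mem_set => i; rewrite mxE clamp01_ge0 clamp01_le1. Qed.

Definition to_cube n (v : 'rV[R]_n) : cube R n := SigSub (cube_of_subproof v).

Definition of_cube n (s : cube R n) : 'rV[R]_n := \row_i (2 * val s 0 i - 1).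

Lemma to_cube_continuous n : continuous (@to_cube n).
Proof.
apply: continuous_comp_initial => v; apply: ct_mx => i /=.
rewrite (_ : (fun x : 'rV_n => _) =
    fun x : 'rV[R]_n => clamp01 ((x 0 i + 1) / 2)); last first.
  by apply/funext => x; rewrite mxE.
by rewrite /clamp01; ctn.
Qed.

Lemma of_cube_continuous n : continuous (@of_cube n).
Proof.
move=> s; apply: ct_mx => i /=.
rewrite (_ : (fun x : cube R n => _) =
    fun x : cube R n => 2 * val x 0 i - 1); last first.
  by apply/funext => x; rewrite mxE.
by ctn.
Qed.

Lemma of_cubeK n (v : 'rV[R]_n) : `|v| <= 1 -> of_cube (to_cube v) = v.
Proof.
move=> /rV_norm_le v1; apply/rowP => i; rewrite !mxE clamp01_id.
  by rewrite mulrC divfK ?pnatr_eq0// addrK.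
by have := v1 ler01 i; rewrite ler_norml; lra.
Qed.

Lemma of_cube_le1 n (s : cube R n) : `|of_cube s| <= 1.
Proof.
apply/rV_norm_le => // i; rewrite mxE ler_norml.
by have /set_mem /(_ i) := valP s; lra.
Qed.

Lemma of_cube_boundary n (s : cube R n) : cube_boundary s -> `|of_cube s| = 1.
Proof.
move=> [i si]; apply/eqP; rewrite eq_le of_cube_le1 /=.
have /rV_norm_le := lexx `|of_cube s|; move=> /(_ (normr_ge0 _) i).
rewrite mxE; apply: le_trans; case: si => ->.
  by rewrite mulr0 sub0r normrN normr1.
by rewrite mulr1 (_ : 2 - 1 = 1 :> R) ?normr1//; lra.
Qed.

Lemma to_cube_boundary n (v : 'rV[R]_n) : `|v| = 1 -> cube_boundary (to_cube v).
Proof.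
move=> v1; have [i vi] := rV_norm1 v1; exists i; rewrite /= mxE.
have [v0|v0] := leP 0 (v 0 i).
  right; move: vi; rewrite ger0_norm// => ->; rewrite clamp01_id; lra.
left; move: vi; rewrite ltr0_norm// => /eqP; rewrite eqr_oppLR => /eqP ->.
by rewrite addNr mul0r clamp01_0.
Qed.

End row.

Section pi_based.
Context {R : realType} (Y Z : topologicalType) (k : continuousType Y Z).

Lemma pi_homotopic q (X : topologicalType) (x : X) (a b : spheroid R q x) :
  \pi_(Defs.pi R q x) a = \pi_(Defs.pi R q x) b <->
  homotopic_rel R (@cube_boundary R q) (val a) (val b).
Proof. by split=> [/eqmodP/asboolP|h]; last exact/eqmodP/asboolP. Qed.

Lemma pi0_path (X : topologicalType) (x y : X) :
  \pi_(pi0 R X) x = \pi_(pi0 R X) y <-> path_connected R x y.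
Proof. by split=> [/eqmodP/asboolP|h]; last exact/eqmodP/asboolP. Qed.

Lemma spheroidP q (X : topologicalType) (x : X) (f : cube R q -> X) :
  continuous f -> (forall s, cube_boundary s -> f s = x) ->
  exists a : spheroid R q x, (val a : cube R q -> X) = f.
Proof.
move=> cf fx.
have fP : (mkcts cf : continuousType (cube R q) X) \in
    [set a : continuousType (cube R q) X |
      forall s, cube_boundary s -> a s = x].
  exact/mem_set.
by exists (SigSub fP).
Qed.

Lemma based_injective_pi q :
  pi_bijective R k q.+1 -> based_injective 'rV[R]_q.+1 k.
Proof.
move=> bij y0 b K cb cK by0 K0 K1 Kw.
have [a aE] : exists a : spheroid R q.+1 y0,
    (val a : _ -> Y) = b \o @of_cube R q.+1.
  apply: spheroidP => [s|s /of_cube_boundary]; last exact: by0.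
  by apply: continuous_comp; [exact: of_cube_continuous|exact: cb].
have [c cE] : exists c : spheroid R q.+1 y0, (val c : _ -> Y) = (fun=> y0).
  by apply: spheroidP => // s; exact: (@ct_cst _ _ y0 s).
have : \pi_(Defs.pi R q.+1 y0) c = \pi_(Defs.pi R q.+1 y0) a.
  apply: (bij_inj (bij y0)); rewrite !pi_mapE; apply/pi_homotopic.
  exists (fun p => K (of_cube p.1, val p.2)); split.
  - move=> p; change (continuous_at p
      (fun p : (cube R q.+1 * unitI R)%type => K (of_cube p.1, val p.2))).
    by ctn; exact: of_cube_continuous.
  - by move=> s /=; rewrite cE K0// of_cube_le1.
  - by move=> s /=; rewrite aE K1// of_cube_le1.
  - move=> s sb t /=; rewrite cE Kw//; first exact: of_cube_boundary.
    by have /set_mem := valP t.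
move=> /pi_homotopic[H [cH H0 H1 Hb]].
exists (fun p => H (to_cube p.1, clampI p.2)); split.
  move=> p; change (continuous_at p
    (fun p : ('rV[R]_q.+1 * R)%type => H (to_cube p.1, clampI p.2))).
  by ctn; [exact: to_cube_continuous|exact: clampI_continuous].
split=> [x x1|x x1|x t x1 t1] /=.
- by rewrite clampI0// H0 cE.
- by rewrite clampI1// H1 aE /= of_cubeK.
- by rewrite Hb ?cE//; exact: to_cube_boundary.
Qed.

Lemma based_injective_pi0 : pi_bijective R k 0 -> based_injective 'rV[R]_0 k.
Proof.
move=> bij y0 b K cb cK by0 K0 K1 Kw.
have : \pi_(pi0 R Y) y0 = \pi_(pi0 R Y) (b 0).
  apply: (bij_inj bij); rewrite !pi0_mapE; apply/pi0_path.
  exists (fun t => K (0, val t)); split.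
  - move=> t; change (continuous_at t (fun t : unitI R => K (0, val t))).
    by ctn.
  - by rewrite /= K0// normr0.
  - by rewrite /= K1// normr0.
move=> /pi0_path[c [cc c0 c1]].
exists (fun p => c (clampI p.2)); split.
  move=> p; change (continuous_at p
    (fun p : ('rV[R]_0 * R)%type => c (clampI p.2))).
  by ctn; exact: clampI_continuous.
split=> [x _|x _|x t].
- by rewrite clampI0.
- by rewrite clampI1//= c1 (thinmx0 x).
- by rewrite (thinmx0 x) normr0 => /esym/eqP; rewrite oner_eq0.
Qed.

Lemma based_surjective_pi q :
  pi_surjective R k q.+1 -> based_surjective 'rV[R]_q.+1 k.
Proof.
move=> surj y0 d cd dy0.
have [e eE] : exists e : spheroid R q.+1 (k y0),
    (val e : _ -> Z) = d \o @of_cube R q.+1.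
  apply: spheroidP => [s|s /of_cube_boundary]; last exact: dy0.
  by apply: continuous_comp; [exact: of_cube_continuous|exact: cd].
have [c] := surj y0 (\pi_(Defs.pi R q.+1 (k y0)) e).
rewrite -[c]reprK pi_mapE => /esym/pi_homotopic; set a := repr c.
move=> [H [cH H0 H1 Hb]].
exists (fun x => val a (to_cube x)), (fun p => H (to_cube p.1, clampI p.2)).
split; [|split].
- move=> x; apply: (@continuous_comp _ _ _ (@to_cube R q.+1) (val a)).
    exact: to_cube_continuous.
  exact: cts_fun.
- move=> p; change (continuous_at p
    (fun p : ('rV[R]_q.+1 * R)%type => H (to_cube p.1, clampI p.2))).
  by ctn; [exact: to_cube_continuous|exact: clampI_continuous].
split=> [x x1|x x1|x x1|x t x1 t1] /=.
- by have /set_mem -> := valP a => //; exact: to_cube_boundary.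
- by rewrite clampI0// H0 eE /= of_cubeK.
- by rewrite clampI1// H1.
- by rewrite Hb ?eE /= ?of_cubeK ?dy0 ?x1//; exact: to_cube_boundary.
Qed.

Lemma ball_help_pi0 : pi_surjective R k 0 -> ball_help 'rV[R]_0 k.
Proof.
move=> surj f g h cf _ _ _ _.
have [c] := surj (\pi_(pi0 R Z) (f 0)).
rewrite -[c]reprK pi0_mapE => /esym/pi0_path[w [cw w0 w1]].
have no (x : 'rV[R]_0) : `|x| = 1 -> False.
  by rewrite (thinmx0 x) normr0 => /esym/eqP; rewrite oner_eq0.
exists (fun=> repr c), (fun p => w (clampI p.2)); split; [|split].
- by move=> x; exact: (@ct_cst _ _ (repr c) x).
- move=> p; change (continuous_at p
    (fun p : ('rV[R]_0 * R)%type => w (clampI p.2))).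
  by ctn; exact: clampI_continuous.
split=> [x /no//|x t /no//|x _|x _] /=.
- by rewrite clampI0// w0 (thinmx0 x).
- by rewrite clampI1.
Qed.

End pi_based.

(** * Changing the ball *)

Section isometry.
Context {R : realType} (V W : normedModType R).
Context (Y Z : topologicalType) (k : Y -> Z).
Context (L : V -> W) (M : W -> V).
Hypotheses (cL : continuous L) (cM : continuous M).
Hypotheses (LK : cancel L M) (MK : cancel M L).
Hypothesis normL : forall x, `|L x| = `|x|.

Let normM w : `|M w| = `|w|.
Proof. by rewrite -normL MK. Qed.

Let M_neq0 w : w != 0 -> M w != 0.
Proof. by move=> w0; rewrite -normr_eq0 normM normr_eq0. Qed.

Lemma based_surjective_isometry : based_surjective V k -> based_surjective W k.
Proof.
move=> surj y0 d cd dy0.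
have [| |a [D [ca [cD [a0 D0 D1 Dw]]]]] := surj y0 (d \o L).
- by move=> x; apply: (continuous_comp (@cL x)); exact: cd.
- by move=> x x1 /=; rewrite dy0 ?normL.
exists (a \o M), (fun p => D (M p.1, p.2)); split; [|split].
- by move=> w; apply: (continuous_comp (@cM w)); exact: ca.
- by move=> p; ctn.
split=> [w w1|w w1|w w1|w t w1 t1] /=.
- by rewrite a0 ?normM.
- by rewrite D0 ?normM//= MK.
- by rewrite D1 ?normM.
- by rewrite Dw ?normM.
Qed.

Lemma ball_help_isometry : ball_help W k -> ball_help V k.
Proof.
move=> hk f g h cf cg ch hf hg.
have [||||| g' [h' [cg' [ch' [g'g h'h h'0 h'1]]]]] :=
  hk (f \o M) (g \o M) (fun p => h (M p.1, p.2)).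
- by move=> w; apply: (continuous_comp (@cM w)); exact: cf.
- move=> w w0; apply: (@ct_comp _ _ _ g M); last exact: cM.
  by apply: cg; exact: M_neq0.
- by move=> p p0; ctn; apply: ch; exact: M_neq0.
- by move=> w w1 /=; rewrite hf ?normM.
- by move=> w w1 /=; rewrite hg ?normM.
exists (g' \o L), (fun p => h' (L p.1, p.2)); split; [|split].
- by move=> x; apply: (continuous_comp (@cL x)); exact: cg'.
- by move=> p; ctn.
split=> [x x1|x t x1 t1|x x1|x x1] /=.
- by rewrite g'g ?normL//= LK.
- by rewrite h'h ?normL//= LK.
- by rewrite h'0 ?normL//= LK.
- by rewrite h'1 ?normL.
Qed.

End isometry.

Section split_row.
Context {R : realType} (n : nat).
Let W : normedModType R := ('rV[R]_n * R)%type.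

Definition row_split (v : 'rV[R]_n.+1) : W :=
  (\row_i v 0 (lift ord0 i), v 0 ord0).

Definition row_join (w : W) : 'rV[R]_n.+1 :=
  \row_i (if unlift ord0 i is Some j then w.1 0 j else w.2).

Lemma row_splitK : cancel row_split row_join.
Proof.
move=> v; apply/rowP => i; rewrite mxE.
by case: unliftP => [j|] ->; rewrite /= ?mxE.
Qed.

Lemma row_joinK : cancel row_join row_split.
Proof.
move=> [x s]; congr (_, _); last by rewrite mxE unlift_none.
by apply/rowP => i; rewrite !mxE liftK.
Qed.

Lemma row_split_norm v : `|row_split v| = `|v|.
Proof.
apply/eqP; rewrite eq_le norm_cylinder ge_max; apply/andP; split.
  have /rV_norm_le := lexx `|v|; move=> /(_ (normr_ge0 _)) vle.
  by rewrite vle andbT; apply/rV_norm_le => // i; rewrite mxE.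
apply/rV_norm_le => [|i]; first by rewrite le_max normr_ge0.
have [j ->|->] := unliftP ord0 i; rewrite le_max; last by rewrite lexx orbT.
have /rV_norm_le := lexx `|(row_split v).1|; move=> /(_ (normr_ge0 _) j).
by rewrite mxE => ->.
Qed.

Lemma row_split_continuous : continuous row_split.
Proof.
move=> v; change (continuous_at v
  (fun v => (\row_i v 0 (lift ord0 i), v 0 ord0) : W)).
apply: (@ct_pair _ _ _ (fun v : 'rV[R]_n.+1 => \row_i v 0 (lift ord0 i)));
  last by ctn.
apply: ct_mx => i.
rewrite (_ : (fun x : 'rV_n.+1 => _) =
    fun x : 'rV[R]_n.+1 => x 0 (lift ord0 i)).
  by ctn.
by apply/funext => x; rewrite mxE.
Qed.

Lemma row_join_continuous : continuous row_join.
Proof.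
move=> w; apply: ct_mx => i.
rewrite (_ : (fun x : W => _) =
    fun x : W => if unlift ord0 i is Some j then x.1 0 j else x.2).
  by case: unlift => [j|]; ctn.
by apply/funext => x; rewrite mxE.
Qed.

End split_row.

Lemma ball_help_cylinder_pi (R : realType) (Y Z : topologicalType)
    (k : continuousType Y Z) q :
  pi_bijective R k q -> pi_surjective R k q.+1 ->
  ball_help ('rV[R]_q * R)%type k.
Proof.
move=> bij surj.
have ck : continuous k by exact: cts_fun.
apply: ball_help_of_deformation => //; apply: cylinder_deformation => //.
  case: q bij {surj} => [|q]; first exact: based_injective_pi0.
  exact: based_injective_pi.
apply: (based_surjective_isometry (@row_split_continuous R q)
  (@row_join_continuous R q) (@row_joinK R q) (@row_split_norm R q)).
exact: based_surjective_pi.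
Qed.

Lemma ball_help_pi (R : realType) (Y Z : topologicalType)
    (k : continuousType Y Z) q :
  pi_bijective R k q -> pi_surjective R k q.+1 -> ball_help 'rV[R]_q.+1 k.
Proof.
move=> bij surj.
apply: (ball_help_isometry (@row_split_continuous R q)
  (@row_join_continuous R q) (@row_splitK R q) (@row_joinK R q) (@row_split_norm R q)).
exact: ball_help_cylinder_pi.
Qed.

Section disk.
Context {R : realType} (n : nat).
Notation V := 'rV[R]_n.

Definition norm2 (v : V) : R := Num.sqrt (\sum_(i < n) v 0 i ^+ 2).

Lemma sqr_norm2 v : norm2 v ^+ 2 = \sum_(i < n) v 0 i ^+ 2.
Proof. by rewrite sqr_sqrtr// sumr_ge0// => i _; exact: sqr_ge0. Qed.

Lemma norm2_ge0 v : 0 <= norm2 v. Proof. exact: sqrtr_ge0. Qed.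

Lemma norm_le_norm2 v : `|v| <= norm2 v.
Proof.
apply/rV_norm_le => [|i]; first exact: norm2_ge0.
rewrite -sqrtr_sqr ler_wsqrtr// (bigD1 i)//= lerDl.
by rewrite sumr_ge0// => j _; exact: sqr_ge0.
Qed.

Lemma norm2Z (c : R) v : norm2 (c *: v) = `|c| * norm2 v.
Proof.
rewrite /norm2 (eq_bigr (fun i => c ^+ 2 * v 0 i ^+ 2)) => [|i _].
  by rewrite -mulr_sumr sqrtrM ?sqr_ge0// sqrtr_sqr.
by rewrite mxE exprMn.
Qed.

Lemma norm2_eq0 v : (norm2 v == 0) = (v == 0).
Proof.
apply/eqP/eqP => [v0|->].
  by apply/normr0_eq0/le_anti; rewrite normr_ge0 andbT -v0 norm_le_norm2.
by rewrite /norm2 big1 ?sqrtr0// => i _; rewrite mxE expr0n.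
Qed.

Lemma norm2_continuous : continuous norm2.
Proof.
move=> v; change (continuous_at v norm2).
apply: (@ct_comp V R R Num.sqrt (fun v => \sum_(i < n) v 0 i ^+ 2)).
  exact: sqrt_continuous.
apply: ct_sum => i.
by change (continuous_at v (fun v : V => v 0 i * v 0 i)); ctn.
Qed.

(** Rescaling along rays from one norm to the other, as in a radial
    homeomorphism of the balls; the numerator bounds the result, which gives
    continuity at the origin. *)
Lemma ct_rescale (a b : V -> R) (v : V) :
  continuous a -> continuous b -> (forall v, v != 0 -> b v != 0) ->
  a 0 = 0 -> (forall v, `|(a v / b v) *: v| <= a v) ->
  continuous_at v (fun v => (a v / b v) *: v).
Proof.
move=> ca cb b0 a0 ab; have [->|v0] := eqVneq v 0; last by ctn; exact: b0.
rewrite /continuous_at scaler0.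
apply/(@cvgr0Pnorm_lt R V V (nbhs (0 : V)) _) => e e0.
have : nbhs (0 : V) [set x | a x < e].
  by apply: (@cvgr_lt _ _ (nbhs (0 : V)) _ a (a 0)); [exact: ca|rewrite a0].
by apply: filterS => x; exact: le_lt_trans.
Qed.

Definition to_norm2 (v : V) : V := (`|v| / norm2 v) *: v.
Definition of_norm2 (v : V) : V := (norm2 v / `|v|) *: v.

Lemma norm2_to v : norm2 (to_norm2 v) = `|v|.
Proof.
rewrite /to_norm2 norm2Z ger0_norm ?divr_ge0 ?norm2_ge0//.
have [->|v0] := eqVneq v 0; first by rewrite normr0 !mul0r.
by rewrite divfK ?norm2_eq0.
Qed.

Lemma norm_of v : `|of_norm2 v| = norm2 v.
Proof.
rewrite /of_norm2 normrZ ger0_norm ?divr_ge0 ?norm2_ge0//.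
have [->|v0] := eqVneq v 0; last by rewrite divfK ?normr_eq0.
by rewrite normr0 mulr0; apply/esym/eqP; rewrite norm2_eq0.
Qed.

Lemma of_norm2K v : to_norm2 (of_norm2 v) = v.
Proof.
rewrite {1}/to_norm2 norm_of /of_norm2 norm2Z ger0_norm ?divr_ge0 ?norm2_ge0//.
have [->|v0] := eqVneq v 0; first by rewrite !scaler0.
have n0 : norm2 v != 0 by rewrite norm2_eq0.
have n1 : `|v| != 0 by rewrite normr_eq0.
rewrite scalerA (_ : _ * _ = 1) ?scale1r//.
by field; rewrite n0 n1.
Qed.

Lemma to_norm2_continuous : continuous to_norm2.
Proof.
move=> v; apply: (@ct_rescale (fun v => `|v|) norm2).
- by move=> x; ctn.
- exact: norm2_continuous.
- by move=> x; rewrite norm2_eq0.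
- by rewrite normr0.
- by move=> x; apply: le_trans (norm_le_norm2 _) _; rewrite norm2_to.
Qed.

Lemma of_norm2_continuous : continuous of_norm2.
Proof.
move=> v; apply: (@ct_rescale norm2 (fun v => `|v|)).
- exact: norm2_continuous.
- by move=> x; ctn.
- by move=> x; rewrite normr_eq0.
- by apply/eqP; rewrite norm2_eq0.
- by move=> x; rewrite norm_of.
Qed.

End disk.

Section ball_help_disk.
Context {R : realType} (n : nat).
Notation V := 'rV[R]_n.

Lemma disk_norm2 (x : disk R n) : norm2 (val x) <= 1.
Proof.
have /set_mem /= x1 := valP x.
by rewrite -(@ler_pXn2r _ 2) ?nnegrE ?norm2_ge0// sqr_norm2 expr1n.
Qed.

Lemma usphere_norm2 (x : usphere R n) : norm2 (val x) = 1.
Proof. by have /set_mem /= x1 := valP x; rewrite /norm2 x1 sqrtr1. Qed.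

Lemma to_disk_subproof (v : V) : to_norm2 ((Num.max 1 `|v|)^-1 *: v) \in
  [set x : V | \sum_(i < n) x 0 i ^+ 2 <= 1].
Proof.
apply/mem_set => /=; rewrite -sqr_norm2 norm2_to expr_le1//.
exact: ball_normalize1.
Qed.

Definition to_disk (v : V) : disk R n := SigSub (to_disk_subproof v).

Definition of_disk (x : disk R n) : V := of_norm2 (val x).

Lemma of_diskK : cancel of_disk to_disk.
Proof.
move=> x; apply: val_inj; rewrite /= ball_normalize_id; first exact: of_norm2K.
by rewrite norm_of disk_norm2.
Qed.

Lemma to_disk_continuous : continuous to_disk.
Proof.
move=> v; apply: ct_sub => /=.
apply: (@ct_comp _ _ _ (@to_norm2 R n) (fun v => (Num.max 1 `|v|)^-1 *: v)).
  exact: to_norm2_continuous.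
by ctn; exact: max1_neq0.
Qed.

Lemma of_disk_continuous : continuous of_disk.
Proof.
move=> x; apply: (@ct_comp _ _ _ (@of_norm2 R n) (fun x : disk R n => val x)).
  exact: of_norm2_continuous.
by ctn.
Qed.

Definition to_usphere (u0 : usphere R n) (v : V) : usphere R n :=
  insubd u0 (to_norm2 (`|v|^-1 *: v)).

Lemma to_usphere_mem (v : V) : v != 0 -> to_norm2 (`|v|^-1 *: v) \in
  [set x : V | \sum_(i < n) x 0 i ^+ 2 = 1].
Proof.
move=> v0; apply/mem_set => /=.
by rewrite -sqr_norm2 norm2_to sphere_normalize ?expr1n.
Qed.

Lemma val_to_usphere u0 v : v != 0 ->
  val (to_usphere u0 v) = to_norm2 (`|v|^-1 *: v).
Proof. by move=> v0; rewrite insubdK//; exact: to_usphere_mem. Qed.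

Lemma to_usphere_continuous u0 : sphere_map (to_usphere u0).
Proof.
move=> v v0; apply: ct_sub.
apply: (@ct_near _ _ _ (fun v => to_norm2 (`|v|^-1 *: v))).
  have : nbhs v [set x : V | 0 < `|x|].
    apply: (@cvgr_gt _ _ (nbhs v) _ (fun x : V => `|x|) `|v|).
      exact: norm_continuous.
    by rewrite normr_gt0.
  by apply: filterS => x; rewrite /= normr_gt0 => x0; exact: val_to_usphere.
apply: (@ct_comp _ _ _ (@to_norm2 R n) (fun v => `|v|^-1 *: v)).
  exact: to_norm2_continuous.
by ctn; rewrite normr_eq0.
Qed.

Lemma of_usphere_norm (x : usphere R n) : `|of_disk (disk_of_usphere x)| = 1.
Proof. by rewrite norm_of usphere_norm2. Qed.

Lemma of_usphereK u0 (x : usphere R n) :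
  to_usphere u0 (of_disk (disk_of_usphere x)) = x.
Proof.
apply: val_inj; rewrite val_to_usphere; last first.
  by exact/sphere_neq0/of_usphere_norm.
by rewrite sphere_normalize_id ?of_usphere_norm//; exact: of_norm2K.
Qed.

Context (Y Z : topologicalType) (k : Y -> Z).

Definition disk_help := forall (f : disk R n -> Z) (g : usphere R n -> Y)
    (h : usphere R n * R -> Z),
  continuous f -> continuous g -> continuous h ->
  (forall x, h (x, 0) = f (disk_of_usphere x)) ->
  (forall x, h (x, 1) = k (g x)) ->
  exists (g' : disk R n -> Y) (h' : disk R n * R -> Z),
   continuous g' /\ continuous h' /\
   [/\ forall x, g' (disk_of_usphere x) = g x,
       forall x t, 0 <= t <= 1 -> h' (disk_of_usphere x, t) = h (x, t),
       forall x, h' (x, 0) = f x &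
       forall x, h' (x, 1) = k (g' x)].

(** Maps are transported along the radial homeomorphism between the two balls.
    The boundary map becomes a map on all of V with an arbitrary value at 0; for
    n = 0 this value cannot be found on the boundary, which is empty, but has to
    come from Z. *)
Lemma disk_help_ball : (Z -> inhabited Y) -> ball_help V k -> disk_help.
Proof.
move=> ZY hk f g h cf cg ch hf hg.
have [gs [cgs gsE]] : exists gs : V -> Y, sphere_map gs /\
    forall x, gs (of_disk (disk_of_usphere x)) = g x.
  have [[u0]|nu0] := pselect (inhabited (usphere R n)).
    exists (fun v => g (to_usphere u0 v)); split=> [v v0|x].
      by apply: (@ct_comp _ _ _ g) => //; exact: to_usphere_continuous.
    by rewrite of_usphereK.
  have [y0] := ZY (f (to_disk 0)).
  exists (fun=> y0); split=> [v _|x]; first exact: (@ct_cst _ _ y0 v).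
  by case: nu0; exists.
have [hs [chs hsE]] : exists hs : V * R -> Z, sphere_homotopy hs /\
    forall x t, hs (of_disk (disk_of_usphere x), t) = h (x, t).
  have [[u0]|nu0] := pselect (inhabited (usphere R n)).
    exists (fun p => h (to_usphere u0 p.1, p.2)); split=> [p p0|x t].
      by ctn; exact: to_usphere_continuous.
    by rewrite of_usphereK.
  exists (fun=> f (to_disk 0)); split=> [p _|x]; first exact: (@ct_cst _ _ _ p).
  by case: nu0; exists.
have sphereE (v : V) : `|v| = 1 -> exists x, v = of_disk (disk_of_usphere x).
  move=> v1; have v0 := sphere_neq0 v1.
  have [x xE] : exists x : usphere R n, val x = to_norm2 v.
    have := to_usphere_mem v0; rewrite sphere_normalize_id// => vP.
    by exists (SigSub vP).
  exists x; rewrite /of_disk /= xE /of_norm2 norm2_to v1.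
  have n0 : norm2 v != 0 by rewrite norm2_eq0.
  have i0 : 1 / norm2 v != 0 by rewrite div1r invr_eq0.
  rewrite /to_norm2 v1 normrZ v1 mulr1 scalerA ger0_norm ?divr_ge0 ?norm2_ge0//.
  by rewrite divfK// scale1r.
have [||||| g' [h' [cg' [ch' [g'g h'h h'0 h'1]]]]] := hk (f \o to_disk) gs hs.
- by move=> v; apply: (continuous_comp (@to_disk_continuous v)); exact: cf.
- by [].
- by [].
- by move=> v /sphereE[x ->]; rewrite hsE hf /= of_diskK.
- by move=> v /sphereE[x ->]; rewrite hsE hg gsE.
have le1 x : `|of_disk x| <= 1 by rewrite norm_of disk_norm2.
exists (g' \o of_disk), (fun p => h' (of_disk p.1, p.2)); split; [|split].
- by move=> x; apply: (continuous_comp (@of_disk_continuous x)); exact: cg'.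
- by move=> p; ctn; exact: of_disk_continuous.
split=> [x|x t t1|x|x].
- by rewrite /= g'g ?of_usphere_norm.
- by rewrite /= h'h ?of_usphere_norm.
- by rewrite /= h'0 ?le1//= of_diskK.
- by rewrite /= h'1.
Qed.

End ball_help_disk.

(** * The path space of an equivariant map *)

Lemma mmapP (M : monoidType) (X Y : mspaceType M) (f : X -> Y) :
  (forall m x, f (act m x) = act m (f x)) -> continuous f ->
  exists F : {mmap X -> Y}, (F : X -> Y) = f.
Proof.
move=> ef cf.
pose i1 := isEquivariant.Build M X Y f ef.
pose i2 := @isContinuous.Build X Y f cf.
by exists (HB.pack f i1 i2 : {mmap X -> Y}).
Qed.

Section path_space.
Import ArrowAsCompactOpen.
Context {R : realType} {M : monoidType} {Y Z : mspaceType M}.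
Context (k : {mmap Y -> Z}).

Definition is_path_to : set (Y * continuousType R Z) :=
  [set q : Y * continuousType R Z |
    q.2 1 = k q.1 /\ forall t : R, q.2 t = q.2 (clamp01 t)].

(** The mapping path space of k. Paths are parametrized by the whole line, as
    maps that factor through the retraction onto [0,1]. *)
Definition path_space : Type := is_path_to.

HB.instance Definition _ := Topological.copy path_space is_path_to.

Definition path_source (q : path_space) : Y := (val q).1.
Definition path_at (p : path_space * R) : Z := (val p.1).2 p.2.

Lemma path_source_continuous : continuous path_source.
Proof.
move=> q; apply: (@ct_fst _ _ _ (fun q : path_space => val q)).
exact: initial_continuous.
Qed.

Lemma path_at_continuous : continuous path_at.
Proof.
move=> p; change (continuous_at p
  (fun p : path_space * R => eval ((val p.1).2, p.2))).
apply: (@ct_comp _ _ _ eval (fun p : path_space * R => ((val p.1).2, p.2))).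
  apply: eval_continuous; first exact: locally_compactR.
  exact: uniform_regular.
apply: (@ct_pair _ _ _ (fun p : path_space * R => (val p.1).2));
  last exact: cvg_snd.
apply: (@ct_snd _ _ _ (fun p : path_space * R => val p.1)).
by ctn.
Qed.

Lemma path_space_eq (q q' : path_space) : path_source q = path_source q' ->
  (forall t, path_at (q, t) = path_at (q', t)) -> q = q'.
Proof.
rewrite /path_source /path_at.
case: q => [[y c] qP]; case: q' => [[y' c'] qP'] /=.
move=> yy' cc'; apply: val_inj => /=; congr (_, _) => //.
by apply/continuousEP => t; exact: cc'.
Qed.

(** A map into the path space amounts to a map into Y and a homotopy in Z ending
    at its image: currying is continuous for the compact-open topology, and the
    line is locally compact, so evaluation is continuous as well. *)
Lemma path_spaceP (T : topologicalType) (g : T -> Y) (h : T * R -> Z) :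
  continuous g -> continuous h -> (forall x, h (x, 1) = k (g x)) ->
  (forall x t, h (x, t) = h (x, clamp01 t)) ->
  exists u : T -> path_space, [/\ continuous u,
    forall x, path_source (u x) = g x &
    forall x t, path_at (u x, t) = h (x, t)].
Proof.
move=> cg ch h1 hc.
have cs x : continuous (fun t => h (x, t)).
  move=> t; change (continuous_at t (fun t => h (x, t))).
  by ctn.
have uP x : (g x, mkcts (cs x) : continuousType R Z) \in is_path_to.
  by apply/mem_set; split; [exact: h1|exact: hc].
have cm : continuous (fun x => mkcts (cs x) : continuousType R Z).
  apply: continuous_comp_initial.
  exact: (@continuous_curry_fun T R Z h).
exists (fun x => SigSub (uP x)); split=> // x.
by apply: ct_sub; apply: (@ct_pair _ _ _ g); [exact: cg|exact: cm].
Qed.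

Lemma path_act_subproof (m : M) (q : path_space) :
  exists q' : path_space, path_source q' = act m (path_source q) /\
    forall t, path_at (q', t) = act m (path_at (q, t)).
Proof.
have [|||| u [_ us ua]] := @path_spaceP (discrete_topology unit)
  (fun=> act m (path_source q)) (fun p => act m (path_at (q, p.2))).
- by move=> x; exact: cvg_cst.
- move=> p; apply: (@ct_comp _ _ _ (act m)
    (fun p : discrete_topology unit * R => path_at (q, p.2))).
    exact: act_continuous1.
  by ctn; exact: path_at_continuous.
- move=> x; rewrite equivariantE; congr (act m _).
  by have /set_mem[] := valP q.
- move=> x t; congr (act m _).
  by have /set_mem[_] := valP q; exact.
by exists (u tt); split=> [|t]; rewrite ?us ?ua.
Qed.

Definition path_act (m : M) (q : path_space) : path_space :=
  projT1 (cid (path_act_subproof m q)).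

Lemma path_source_act m q : path_source (path_act m q) = act m (path_source q).
Proof. by rewrite /path_act; case: cid => q' []. Qed.

Lemma path_at_act m q t : path_at (path_act m q, t) = act m (path_at (q, t)).
Proof. by rewrite /path_act; case: cid => q' []. Qed.

Lemma path_act1 q : path_act 1%g q = q.
Proof.
by apply: path_space_eq => [|t]; rewrite ?path_source_act ?path_at_act act1.
Qed.

Lemma path_actM m n q : path_act (m * n)%g q = path_act m (path_act n q).
Proof.
by apply: path_space_eq => [|t]; rewrite ?path_source_act ?path_at_act actM.
Qed.

HB.instance Definition _ :=
  @isMSet.Build M path_space path_act path_act1 path_actM.

Lemma path_act_continuous (m : M) :
  continuous (act m : path_space -> path_space).
Proof.
have [|||| u [cu us ua]] := @path_spaceP path_space
  (fun q => act m (path_source q)) (fun p => act m (path_at p)).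
- move=> q; apply: (@ct_comp _ _ _ (act m) path_source).
    exact: act_continuous1.
  exact: path_source_continuous.
- move=> p; apply: (@ct_comp _ _ _ (act m) path_at).
    exact: act_continuous1.
  exact: path_at_continuous.
- move=> q; rewrite equivariantE; congr (act m _).
  by have /set_mem[] := valP q.
- move=> q t; congr (act m _).
  by have /set_mem[_] := valP q; exact.
rewrite (_ : act m = u)//; apply/funext => q.
by apply: path_space_eq => [|t]; rewrite ?us ?ua ?path_source_act ?path_at_act.
Qed.

HB.instance Definition _ := @isMSpace.Build M path_space
  (act_continuousW path_act_continuous).

End path_space.

(** * Equivariant lifting *)

Section free.
Context (M : monoidType).

Definition free_mset (P : choiceType) : Type := (M * P)%type.

HB.instance Definition _ (P : choiceType) :=
  Choice.copy (free_mset P) (M * P)%type.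

Definition free_act (P : choiceType) (m : M) (q : free_mset P) : free_mset P :=
  ((m * q.1)%g, q.2).

Lemma free_act1 (P : choiceType) (q : free_mset P) : free_act 1%g q = q.
Proof. by case: q => n p; rewrite /free_act mul1g. Qed.

Lemma free_actM (P : choiceType) (m n : M) (q : free_mset P) :
  free_act (m * n)%g q = free_act m (free_act n q).
Proof. by rewrite /free_act /= mulgA. Qed.

HB.instance Definition _ (P : choiceType) := @isMSet.Build M (free_mset P)
  (@free_act P) (@free_act1 P) (@free_actM P).

(** A projective M-set is a retract of a free one. An element p thus becomes
    act (mu p) (sigma p), where sigma is invariant and mu equivariant, so that
    equivariant maps on P can be built from arbitrary families of values at the
    elements sigma p. *)
Lemma projective_coordinates (P : msetType M) : projective P ->
  exists (mu : P -> M) (sigma : P -> P),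
  [/\ forall m p, mu (act m p) = (m * mu p)%g,
      forall m p, sigma (act m p) = sigma p &
      forall p, act (mu p) (sigma p) = p].
Proof.
move=> projP.
pose f (q : free_mset P) : P := act q.1 q.2.
have ef m q : f (act m q) = act m (f q) by rewrite /f /= actM.
pose F : equivariantType (free_mset P) P :=
  HB.pack f (isEquivariant.Build M _ _ f ef).
have [p|s sK] := projP (free_mset P) F.
  by exists (1%g, p); rewrite /= /f act1.
exists (fun p => (s p).1), (fun p => (s p).2); split=> [m p|m p|p].
- by rewrite equivariantE.
- by rewrite equivariantE.
- exact: (sK p).
Qed.

End free.

Section lifting.
Context {R : realType} {M : monoidType} {Y Z : mspaceType M}.
Context (k : {mmap Y -> Z}).
Local Notation N := (@path_space R M Y Z k).

Lemma path_end (q : N) : path_at (q, 1) = k (path_source q).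
Proof. by have /set_mem[] := valP q. Qed.

Lemma path_clamp (q : N) t : path_at (q, t) = path_at (q, clamp01 t).
Proof. by have /set_mem[_] := valP q; exact. Qed.

Lemma path_sourceM m (q : N) : path_source (act m q) = act m (path_source q).
Proof. exact: path_source_act. Qed.

Lemma path_atM m (q : N) t : path_at (act m q, t) = act m (path_at (q, t)).
Proof. exact: path_at_act. Qed.

Definition lift_of (X : mspaceType M) (f : X -> Z) (u : X -> N) : Prop :=
  forall x, path_at (u x, 0) = f x.

(** The lifting problem is solved without equivariance over one cell for each p,
    and the equivariant solution takes at p the value that the solution over the
    cell sigma p has, translated by mu p. *)
Lemma cell_lift (P : msetType M) n (f : {mmap cell R P n -> Z})
    (u : {mmap cell_boundary R P n -> N}) :
  projective P -> @disk_help R n _ _ k ->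
  lift_of (fun b => f (cell_incl b)) u ->
  exists u' : {mmap cell R P n -> N},
    (forall b, u' (cell_incl b) = u b) /\ lift_of f u'.
Proof.
move=> /projective_coordinates[mu [sigma [muM sigmaM musigma]]] hk uf.
have cu : continuous u by exact: cts_fun.
have cf : continuous f by exact: cts_fun.
have incl (T : topologicalType) (p : P) :
    continuous (fun x : T => (p, x) : discrete_topology P * T).
  move=> x; apply: (@ct_pair _ _ _ (fun=> p : discrete_topology P)) => //.
  exact: (@ct_cst _ _ (p : discrete_topology P) x).
have sol (p : P) : exists gh : (disk R n -> Y) * (disk R n * R -> Z),
    [/\ continuous gh.1, continuous gh.2 &
     [/\ forall x, gh.1 (disk_of_usphere x) = path_source (u (p, x)),
         forall x t, 0 <= t <= 1 ->
           gh.2 (disk_of_usphere x, t) = path_at (u (p, x), t),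
         forall x, gh.2 (x, 0) = f (p, x) &
         forall x, gh.2 (x, 1) = k (gh.1 x)]].
  have [||||| g [h [cg [ch gh]]]] := hk (fun x => f (p, x))
      (fun x => path_source (u (p, x))) (fun q => path_at (u (p, q.1), q.2)).
  - move=> x; apply: (@ct_comp _ _ _ f (fun x => (p, x))); first exact: cf.
    exact: incl.
  - move=> x.
    apply: (@ct_comp _ _ _ (@path_source R M Y Z k) (fun x => u (p, x))).
      exact: path_source_continuous.
    by apply: (@ct_comp _ _ _ u (fun x => (p, x))); [exact: cu|exact: incl].
  - move=> q; apply: (@ct_comp _ _ _ (@path_at R M Y Z k)
      (fun q : usphere R n * R => (u (p, q.1), q.2))).
      exact: path_at_continuous.
    apply: (@ct_pair _ _ _ (fun q : usphere R n * R => u (p, q.1)));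
      last exact: cvg_snd.
    apply: (@ct_comp _ _ _ (fun x => u (p, x)) fst); last exact: cvg_fst.
    by apply: (@ct_comp _ _ _ u (fun x => (p, x))); [exact: cu|exact: incl].
  - by move=> x; rewrite uf.
  - by move=> x; exact: path_end.
  by exists (g, h).
have [S SP] := choice sol.
pose G (c : cell R P n) : Y := act (mu c.1) ((S (sigma c.1)).1 c.2).
pose H (q : cell R P n * R) : Z :=
  act (mu q.1.1) ((S (sigma q.1.1)).2 (q.1.2, clamp01 q.2)).
have [|||| u' [cu' us ua]] := @path_spaceP R M Y Z k (cell R P n) G H.
- move=> c; apply: (@ct_discrete _ _ _ P
    (fun p x => act (mu p) ((S (sigma p)).1 x)) fst snd).
  + exact: cvg_fst.
  + exact: cvg_snd.
  + apply: (@ct_comp _ _ _ (act (mu c.1)) ((S (sigma c.1)).1)).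
      exact: act_continuous1.
    by have [cS _ _] := SP (sigma c.1); exact: cS.
- move=> q; apply: (@ct_discrete _ _ _ P
    (fun p x => act (mu p) ((S (sigma p)).2 x))
    (fun q => q.1.1) (fun q => (q.1.2, clamp01 q.2))).
  + by ctn.
  + by rewrite /clamp01; ctn.
  + apply: (@ct_comp _ _ _ (act (mu q.1.1)) ((S (sigma q.1.1)).2)).
      exact: act_continuous1.
    by have [_ cS _] := SP (sigma q.1.1); exact: cS.
- move=> c; rewrite /H /G /= clamp01_1 equivariantE.
  by have [_ _ [_ _ _ ->]] := SP (sigma c.1).
- move=> c t; rewrite /H /= [clamp01 (clamp01 t)]clamp01_id//.
  by rewrite clamp01_ge0 clamp01_le1.
have eu' m c : u' (act m c) = act m (u' c).
  case: c => p x; apply: path_space_eq => [|t].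
    by rewrite path_sourceM !us /G /= muM sigmaM actM.
  by rewrite path_atM !ua /H /= muM sigmaM actM.
have [U UE] := mmapP eu' cu'.
exists U; rewrite UE; split=> [[p x]|[p x]].
- have [_ _ [S1 S2 _ _]] := SP (sigma p).
  have uE : u (p, x) = act (mu p) (u (sigma p, x)).
    by rewrite -equivariantE /= -[in LHS](musigma p).
  apply: path_space_eq => [|t].
    by rewrite us /G /= S1 uE path_sourceM.
  rewrite ua /H /= S2; last by rewrite clamp01_ge0 clamp01_le1.
  by rewrite -path_atM -uE -path_clamp.
- have [_ _ [_ _ S3 _]] := SP (sigma p).
  rewrite ua /H /= clamp01_0 S3 -equivariantE /=.
  by congr (f (_, _)); exact: musigma.
Qed.

End lifting.

Section skeleta.
Context {R : realType} {M : monoidType} {Y Z : mspaceType M}.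
Context (k : {mmap Y -> Z}).
Local Notation N := (@path_space R M Y Z k).
Local Notation lift_of := (@lift_of R M Y Z k _).

Lemma path_startP : exists p : {mmap N -> Z}, forall q, p q = path_at (q, 0).
Proof.
have [||p pE] := @mmapP M N Z (fun q => path_at (q, 0)).
- by move=> m q; exact: path_atM.
- move=> q; apply: (@ct_comp _ _ _ (@path_at R M Y Z k) (fun q : N => (q, 0))).
    exact: path_at_continuous.
  apply: (@ct_pair _ _ _ (fun q : N => q)); first exact: cvg_id.
  exact: (@ct_cst _ _ (0 : R) q).
by exists p => q; rewrite pE.
Qed.

Context {X : mspaceType M} (c : projective_CW_structure R X).
Context (f : {mmap X -> Z}).

Lemma skel_lift0 : @disk_help R 0 _ _ k ->
  exists u : {mmap skel c 0 -> N}, lift_of (f \o skel_to c 0) u.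
Proof.
move=> hk; have [s [_ sK]] := skel0_iso c.
have empty (x : usphere R 0) : False.
  have /set_mem /= := valP x.
  by rewrite big_ord0 => /esym/eqP; rewrite oner_eq0.
have o_mem : (0 : 'rV[R]_0) \in
    [set x : 'rV[R]_0 | \sum_(i < 0) x 0 i ^+ 2 <= 1].
  by apply/mem_set; rewrite /= big_ord0.
pose o : disk R 0 := SigSub o_mem.
have [||e eE] := @mmapP M (cell_boundary R (cells c 0) 0) N
    (fun b => False_rect _ (empty b.2)).
- by move=> m b; case: (empty b.2).
- by move=> b; case: (empty b.2).
have [||v vE] := @mmapP M (cell R (cells c 0) 0) Z
    (fun b => f (skel_to c 0 (skel0 c b.1))).
- by move=> m b; rewrite -!equivariantE.
- move=> b; apply: (@ct_comp _ _ _ (f \o skel_to c 0 \o skel0 c) fst).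
    exact: cts_fun.
  exact: cvg_fst.
have [|u [_ uv]] :=
  @cell_lift R M Y Z k _ 0 v e (@cells_projective R M X c 0) hk.
  by move=> b; case: (empty b.2).
have [||w wE] := @mmapP M (skel c 0) N (fun x => u (s x, o)).
- by move=> m x; rewrite -equivariantE; congr (u (_, _)); exact: equivariantE.
- move=> x; apply: (@ct_comp _ _ _ u
    (fun x => (s x, o : trivial_action M (disk R 0)))).
    exact: cts_fun.
  apply: (@ct_pair _ _ _ s); first exact: cts_fun.
  exact: (@ct_cst _ _ (o : trivial_action M (disk R 0)) x).
by exists w => x; rewrite wE uv vE /= sK.
Qed.

(** The pushout property extends u by a lift over the new cells. That the result
    lies over f follows from its uniqueness part, applied to maps into Z. *)
Lemma skel_liftS n (u : {mmap skel c n -> N}) : @disk_help R n.+1 _ _ k ->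
  lift_of (f \o skel_to c n) u ->
  exists u' : {mmap skel c n.+1 -> N},
    u' \o skel_incl c n =1 u /\ lift_of (f \o skel_to c n.+1) u'.
Proof.
move=> hk uf; have [comm univ] := skel_pushout c n.
have [compat _] := skel_colimit c.
have [|v [vu vf]] := @cell_lift R M Y Z k _ n.+1
    (f \o skel_to c n.+1 \o char_map c n) (u \o attach c n) (@cells_projective R M X c n.+1) hk.
  move=> b; rewrite /= uf /= -(compat n) /=.
  by congr (f (skel_to c n.+1 _)); exact: comm.
have [|w [wu wv _]] := univ N u v; first by move=> b; rewrite /= vu.
exists w; split=> // x.
have [p pE] := path_startP.
have [|z [_ _ zE]] := univ Z (f \o skel_to c n.+1 \o skel_incl c n)
    (f \o skel_to c n.+1 \o char_map c n).
  by move=> b; congr (f (skel_to c n.+1 _)); exact: comm.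
rewrite -pE; transitivity (z x).
  apply: (zE (p \o w)) => [y|y].
    by rewrite /= pE; have /= -> := wu y; rewrite uf /= -(compat n).
  by rewrite /= pE; have /= -> := wv y; rewrite vf.
by apply/esym; apply: (zE (f \o skel_to c n.+1)).
Qed.

Lemma skel_lift d : (forall m, (m <= d)%N -> @disk_help R m _ _ k) ->
  exists u : {mmap skel c d -> N}, lift_of (f \o skel_to c d) u.
Proof.
elim: d => [|d IHd] hk; first by apply: skel_lift0; exact: hk.
have [m md|u uf] := IHd; first by apply: hk; exact: leqW.
by have [|w [_ wf]] := skel_liftS _ uf; [exact: hk|exists w].
Qed.

Lemma colim_lift : (forall m, @disk_help R m _ _ k) ->
  exists u : {mmap X -> N}, lift_of f u.
Proof.
move=> hk.
pose T n := {u : {mmap skel c n -> N} | lift_of (f \o skel_to c n) u}.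
have [u0 u0f] := skel_lift0 (hk 0).
have step n (u : T n) : {u' : T n.+1 | sval u' \o skel_incl c n =1 sval u}.
  apply: cid; case: u => u uf; have [u' [u'u u'f]] := skel_liftS (hk n.+1) uf.
  by exists (exist _ u' u'f).
pose U := fix U n : T n :=
  if n is m.+1 then sval (step m (U m)) else exist _ u0 u0f.
have UE n : sval (U n.+1) \o skel_incl c n =1 sval (U n) :=
  svalP (step n (U n)).
have [compat univ] := skel_colimit c.
have [u [uU _]] := univ N (fun n => sval (U n)) UE.
exists u => x; have [p pE] := path_startP.
have [|z [_ zE]] := univ Z (fun n => f \o skel_to c n).
  by move=> n y; rewrite /= -(compat n).
rewrite -pE; transitivity (z x); last by apply/esym; apply: (zE f).
apply: (zE (p \o u)) => n y; rewrite /= pE; have /= -> := uU n y.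
exact: (svalP (U n)).
Qed.

Lemma lift_M_homotopic (u : {mmap X -> N}) : lift_of f u ->
  exists g : {mmap X -> Y}, @M_homotopic R M _ _ f (k \o g).
Proof.
move=> uf.
have [||g gE] := @mmapP M X Y (fun x => path_source (u x)).
- by move=> m x; rewrite equivariantE path_sourceM.
- move=> x; apply: (@ct_comp _ _ _ (@path_source R M Y Z k) u).
    exact: path_source_continuous.
  exact: cts_fun.
exists g.
have [||H HE] := @mmapP M (X * trivial_action M (unitI R))%type Z
    (fun p => path_at (u p.1, val (p.2 : unitI R))).
- by move=> m p; rewrite equivariantE path_atM.
- move=> p; apply: (@ct_comp _ _ _ (@path_at R M Y Z k)
      (fun p : (X * unitI R)%type => (u p.1, val p.2))).
    exact: path_at_continuous.
  apply: (@ct_pair _ _ _ (fun p : (X * unitI R)%type => u p.1)).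
    by apply: (@ct_comp _ _ _ u fst); [exact: cts_fun|exact: cvg_fst].
  by apply: (@ct_val _ _ _ snd); exact: cvg_snd.
exists H; split=> x; rewrite HE /=; first exact: uf.
by rewrite gE path_end.
Qed.

End skeleta.

(** * Equivariant homotopies *)

Section M_homotopy.
Context {R : realType} {M : monoidType}.
Implicit Types X Y Z : mspaceType M.
Local Notation I := (unitI R).
Local Notation M_homotopic := (@M_homotopic R M _ _).

Lemma M_homotopic_comp X Y Z (V : mspaceType M) (a : {mmap Y -> V})
    (f g : {mmap X -> Y}) (b : {mmap Z -> X}) :
  M_homotopic f g -> M_homotopic (a \o f \o b) (a \o g \o b).
Proof.
move=> [H [H0 H1]].
have [||K KE] := @mmapP M (Z * trivial_action M I)%type V
    (fun p => a (H (b p.1, p.2))).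
- move=> m p; rewrite -!equivariantE /=.
  by congr (a (H (_, _))); exact: equivariantE.
- move=> p; apply: (@ct_comp _ _ _ (a \o H)
    (fun p : (Z * trivial_action M I)%type => (b p.1, p.2))).
    exact: cts_fun.
  apply: (@ct_pair _ _ _ (fun p : (Z * trivial_action M I)%type => b p.1));
    last exact: cvg_snd.
  by apply: (@ct_comp _ _ _ b fst); [exact: cts_fun|exact: cvg_fst].
by exists K; split=> x; rewrite KE /= ?H0 ?H1.
Qed.

Lemma M_homotopic_time X Y (f g : {mmap X -> Y}) : M_homotopic f g ->
  exists h : X * R -> Y,
  [/\ continuous h, forall m x t, h (act m x, t) = act m (h (x, t)),
    forall x, h (x, 0) = f x & forall x, h (x, 1) = g x].
Proof.
move=> [H [H0 H1]]; exists (fun p => H (p.1, clampI p.2)).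
split=> [p|m x t|x|x].
- apply: (@ct_comp _ _ _ H
    (fun p : X * R => (p.1, clampI p.2 : trivial_action M I))).
    exact: cts_fun.
  apply: (@ct_pair _ _ _ fst
    (fun p : X * R => clampI p.2 : trivial_action M I)).
    exact: cvg_fst.
  apply: (@ct_comp _ _ _ (@clampI R) snd); last exact: cvg_snd.
  exact: clampI_continuous.
- by rewrite -equivariantE.
- by rewrite /= clampI0.
- by rewrite /= clampI1.
Qed.

Lemma time_M_homotopic X Y (f g : {mmap X -> Y}) (h : X * R -> Y) :
  continuous h -> (forall m x t, h (act m x, t) = act m (h (x, t))) ->
  (forall x, h (x, 0) = f x) -> (forall x, h (x, 1) = g x) -> M_homotopic f g.
Proof.
move=> ch eh h0 h1.
have [||K KE] := @mmapP M (X * trivial_action M I)%type Y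
    (fun p => h (p.1, val (p.2 : I))).
- by move=> m p; rewrite -eh.
- move=> p; apply: (@ct_comp _ _ _ h (fun p : X * I => (p.1, val p.2))).
    exact: ch.
  apply: (@ct_pair _ _ _ fst (fun p : X * I => val p.2)); first exact: cvg_fst.
  by apply: (@ct_val _ _ _ snd); exact: cvg_snd.
by exists K; split=> x; rewrite KE /= ?h0 ?h1.
Qed.

Lemma M_homotopic_sym X Y (f g : {mmap X -> Y}) :
  M_homotopic f g -> M_homotopic g f.
Proof.
move=> /M_homotopic_time[h [ch eh h0 h1]].
apply: (@time_M_homotopic _ _ _ _ (fun p => h (p.1, 1 - p.2)))
  => [p|m x t|x|x] /=.
- by change (continuous_at p (fun p : X * R => h (p.1, 1 - p.2))); ctn.
- by rewrite eh.
- by rewrite subr0 h1.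
- by rewrite subrr h0.
Qed.

Lemma M_homotopic_trans X Y (f g h : {mmap X -> Y}) :
  M_homotopic f g -> M_homotopic g h -> M_homotopic f h.
Proof.
move=> /M_homotopic_time[H [cH eH H0 H1]] /M_homotopic_time[K [cK eK K0 K1]].
apply: (@time_M_homotopic _ _ _ _
  (fun p => if 2 * p.2 - 1 <= 0 then H (p.1, 2 * p.2)
            else K (p.1, 2 * p.2 - 1)))
  => [p|m x t|x|x] /=.
- apply: ct_paste; first by ctn.
  + by move=> _; ctn.
  + by move=> _; ctn.
  + move=> p2; have -> : 2 * p.2 = 1 by lra.
    by rewrite subrr H1 K0.
- by case: ifP.
- by rewrite mulr0 ifT ?H0//; lra.
- rewrite ifF; last by apply/negbTE; rewrite -ltNge; lra.
  by rewrite -K1; congr (K (_, _)); lra.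
Qed.

End M_homotopy.

Section whitehead.
Context {R : realType} {M : monoidType}.
Local Notation M_homotopic := (@M_homotopic R M _ _).

Definition lifts_from (X Y Z : mspaceType M) (k : {mmap Y -> Z}) :=
  forall f : {mmap X -> Z}, exists g : {mmap X -> Y}, M_homotopic f (k \o g).

Lemma lifts_from_CW (X Y Z : mspaceType M) (k : {mmap Y -> Z})
    (c : projective_CW_structure R X) :
  (forall m, @disk_help R m _ _ k) -> lifts_from X k.
Proof.
by move=> hk f; have [u uf] := colim_lift c f hk; exact: lift_M_homotopic uf.
Qed.

Lemma lifts_from_dim (X Y Z : mspaceType M) (k : {mmap Y -> Z})
    (c : projective_CW_structure R X) d : CW_dimension c d ->
  (forall m, (m <= d)%N -> @disk_help R m _ _ k) -> lifts_from X k.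
Proof.
move=> [[r [_ rK]] _] hk f; have [u uf] := skel_lift c f hk.
apply: (@lift_M_homotopic _ _ _ _ _ _ f (u \o r)) => x.
by rewrite /= uf /= rK.
Qed.

(** A right inverse g of k up to homotopy has itself a right inverse k' if maps
    from Y lift along g; then k' is homotopic to k g k', hence to k. *)
Lemma two_sided_inverse (Y Z : mspaceType M) (k : {mmap Y -> Z}) :
  lifts_from Z k ->
  (forall g : {mmap Z -> Y}, M_homotopic idfun (k \o g) -> lifts_from Y g) ->
  M_homotopy_equivalence R k.
Proof.
move=> liftZ liftY; have [g kg] := liftZ idfun; exists g.
split; last exact: M_homotopic_sym.
have [k' gk'] := liftY g kg idfun.
have e1 : M_homotopic (g \o k) (g \o k \o (g \o k')).
  exact: (M_homotopic_comp (g \o k) idfun gk').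
have e2 : M_homotopic (g \o k') (g \o k \o (g \o k')).
  exact: (M_homotopic_comp g k' kg).
apply: (M_homotopic_trans e1); apply: (M_homotopic_trans (M_homotopic_sym e2)).
exact: M_homotopic_sym.
Qed.

Lemma pi0_inhabited (Y Z : topologicalType) (k : continuousType Y Z) :
  pi_surjective R k 0 -> Z -> inhabited Y.
Proof.
by move=> surj z; have [c _] := surj (\pi_(pi0 R Z) z); exists; exact: repr c.
Qed.

Lemma pi_bijective_surjective (Y Z : topologicalType)
    (k : continuousType Y Z) q :
  pi_bijective R k q -> pi_surjective R k q.
Proof.
case: q => [[h _ hK] d|q bij x d]; first by exists (h d).
by have [h _ hK] := bij x; exists (h d).
Qed.

Lemma disk_help_pi (Y Z : mspaceType M) (k : {mmap Y -> Z}) n :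
  (forall q, (q < n)%N -> pi_bijective R k q) -> pi_surjective R k n ->
  @disk_help R n _ _ k.
Proof.
move=> bij surj.
have surj0 : pi_surjective R k 0.
  case: n bij surj => [//|n] bij _.
  by apply: pi_bijective_surjective; exact: bij.
apply: disk_help_ball; first exact: pi0_inhabited.
case: n bij surj => [|n] bij surj; first exact: ball_help_pi0.
by apply: ball_help_pi => //; exact: bij.
Qed.

(** Lifting along g over the n-disk uses k one dimension higher, which is why the
    dimensions have to stay below the connectivity of k. *)
Lemma disk_help_section (Y Z : mspaceType M) (k : {mmap Y -> Z})
    (g : {mmap Z -> Y}) n :
  pi_bijective R k n -> pi_surjective R k n.+1 ->
  M_homotopic idfun (k \o g) -> @disk_help R n _ _ g.
Proof.
move=> bij surj /M_homotopic_sym/M_homotopic_time[h [ch _ h0 h1]].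
apply: disk_help_ball; first by move=> y; exists; exact: k y.
apply: ball_help_of_deformation; first exact: cts_fun.
apply: (@section_deformation _ _ _ _ k g h) => //; try exact: cts_fun.
exact: ball_help_cylinder_pi.
Qed.

End whitehead.

Theorem corollary2p7 (R : realType) (M : monoidType) (Y Z : mspaceType M)
    (cY : projective_CW_structure R Y) (cZ : projective_CW_structure R Z)
    (k : {mmap Y -> Z}) :
  (weak_equivalence R k -> M_homotopy_equivalence R k) /\
  (forall n : nat, CW_dimension_lt cY n -> CW_dimension_lt cZ n ->
     n_equivalence R n k -> M_homotopy_equivalence R k).
Proof.
split=> [wk|n [dY dimY dYn] [dZ dimZ dZn] [bij surj]].
  apply: two_sided_inverse => [|g kg].
    apply: (lifts_from_CW cZ) => m; apply: disk_help_pi => [q _|]; first exact: wk.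
    by apply: pi_bijective_surjective; exact: wk.
  apply: (lifts_from_CW cY) => m; apply: disk_help_section kg; first exact: wk.
  by apply: pi_bijective_surjective; exact: wk.
have surj' m : (m <= n)%N -> pi_surjective R k m.
  rewrite leq_eqVlt => /orP[/eqP -> //|mn].
  by apply: pi_bijective_surjective; exact: bij.
apply: two_sided_inverse => [|g kg].
  apply: (lifts_from_dim dimZ) => m md; apply: disk_help_pi => [q qm|].
    by apply: bij; apply: (leq_trans qm); apply: (leq_trans md); exact: ltnW.
  by apply: surj'; apply: (leq_trans md); exact: ltnW.
apply: (lifts_from_dim dimY) => m md.
have mn : (m < n)%N by exact: leq_ltn_trans md dYn.
by apply: disk_help_section kg; [exact: bij|exact: surj'].
Qed.
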